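(* Let $p\in\mathbb{N}$ and $f\in A_p$. Then $f\in R(G)$ if and only if $f$ may be written as $f=g^{-1}h$, where $g,h\in H$ are germs of finite even order $2s$ (for some $s\in\mathbb{N}$), $g^2=h^2$, $s$ divides $p$, and $p/s$ is odd.
   Context: $G$ denotes the group (under composition) of biholomorphic germs at $0$ in one complex variable: germs of functions $f$ holomorphic near $0$ with $f(0)=0$ and $f'(0)\neq 0$. $H=\{f\in G: f'(0)=\exp(i\pi q)\text{ for some } q\in\mathbb{Q}\}$. $G_1=\{f\in G: f'(0)=1\}$, and for $p\in\mathbb{N}$, $G_p=\{f\in G_1: f^{(k)}(0)=0 \text{ for } 2\le k\le p\}$ and $A_p=G_p\setminus G_{p+1}$. $R(G)$ is the set of $f\in G$ that are reversible in $G$, i.e. for which some $g\in G$ satisfies $g^{-1}\circ f\circ g=f^{-1}$. *)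

(* Defs.v *)
From Stdlib Require Import Reals.
From Coquelicot Require Import Coquelicot.
Open Scope R_scope.

(** Germs at 0 are represented by functions C -> C, compared up to equality
    on a neighbourhood of 0. *)
Definition germ_eq (f g : C -> C) : Prop :=
  exists eps : R, 0 < eps /\ forall z : C, Cmod z < eps -> f z = g z.

Definition Cid : C -> C := fun z => z.
Definition Ccomp (f g : C -> C) : C -> C := fun z => f (g z).

Definition cderiv (f : C -> C) (z l : C) : Prop :=
  @is_derive C_AbsRing C_NormedModule f z l.

Definition holo_near0 (f : C -> C) : Prop :=
  exists eps : R, 0 < eps /\
    forall z : C, Cmod z < eps -> @ex_derive C_AbsRing C_NormedModule f z.

(** G : biholomorphic germs at 0 (f(0)=0, f'(0) <> 0). *)
Definition inG (f : C -> C) : Prop :=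
  holo_near0 f /\ f (RtoC 0) = RtoC 0 /\
  exists c : C, cderiv f (RtoC 0) c /\ c <> RtoC 0.

Definition germ_inv (f finv : C -> C) : Prop :=
  germ_eq (Ccomp finv f) Cid /\ germ_eq (Ccomp f finv) Cid.

Fixpoint germ_pow (f : C -> C) (k : nat) : C -> C :=
  match k with
  | O => Cid
  | S k' => Ccomp f (germ_pow f k')
  end.

Definition inH (f : C -> C) : Prop :=
  inG f /\ exists (a : Z) (b : nat), (0 < b)%nat /\
    cderiv f (RtoC 0)
      (cos (PI * (IZR a / INR b)), sin (PI * (IZR a / INR b))).

(** D is a tower of successive complex derivatives of f on the disc |z|<eps:
    D 0 = f near 0 and (D k)' = D (k+1) near 0.  Then D k 0 = f^(k)(0). *)
Definition deriv_tower (f : C -> C) (D : nat -> C -> C) (eps : R) : Prop :=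
  0 < eps /\
  (forall z : C, Cmod z < eps -> D O z = f z) /\
  (forall (k : nat) (z : C), Cmod z < eps -> cderiv (D k) z (D (S k) z)).

Definition inG1 (f : C -> C) : Prop :=
  inG f /\ cderiv f (RtoC 0) (RtoC 1).

Definition inGp (p : nat) (f : C -> C) : Prop :=
  inG1 f /\ exists (D : nat -> C -> C) (eps : R), deriv_tower f D eps /\
    forall k : nat, (2 <= k <= p)%nat -> D k (RtoC 0) = RtoC 0.

Definition inAp (p : nat) (f : C -> C) : Prop :=
  inGp p f /\ ~ inGp (S p) f.

Definition reversible (f : C -> C) : Prop :=
  exists g ginv finv : C -> C,
    inG g /\ germ_inv g ginv /\ germ_inv f finv /\
    germ_eq (Ccomp ginv (Ccomp f g)) finv.

Definition has_order (g : C -> C) (n : nat) : Prop :=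
  (0 < n)%nat /\ germ_eq (germ_pow g n) Cid /\
  forall k : nat, (0 < k < n)%nat -> ~ germ_eq (germ_pow g k) Cid.

(* Main.v *)
Require Import Defs.
From Stdlib Require Import Reals Lra Lia Arith Classical ClassicalEpsilon.
From Coquelicot Require Import Coquelicot.
Open Scope R_scope.

(** If [g] reverses [f], that is [f g f = g], and [f z = z + b z^(p+1) + ...]
    with [b <> 0], comparing leading terms gives [l^p = -1] for the multiplier
    [l] of [g].  So [l] is a root of unity of order [2s] with [p/s] odd.  The
    germ [k = g^(2s)] is tangent to the identity and commutes with [f] and [g].
    If [k] were not the identity, commuting with [f] would make it tangent to
    the identity to the same order [p], and commuting with [g] would then force
    [l^p = 1].  Hence [g] has order [2s], and so has [h = g f], whose square is
    [g^2].  Conversely, [f = g^-1 h] with [g^2 = h^2] is reversed by [g].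

    That a holomorphic germ is zero or has a leading term is proved from
    pointwise complex differentiability: Goursat's theorem on rectangles,
    transported by the exponential, makes circle means independent of the
    radius; this gives the Cauchy formula, whose kernel is then expanded. *)

(** * Complex differentiation *)

(** The comparisons of leading terms all involve a difference such as [g (f z) - g z], which has the
    size of z^(p+1), whereas g(z) = l z + o(z) allows an error that may be far larger. The remainder
    of g must therefore be small on increments, with a bound proportional to the distance of the two
    points; the Cauchy kernel delivers exactly this. For commuting germs with perturbation
    coefficients b and c at orders p+1 and q+1 the comparison is a bracket: the coefficient (p - q)
    b c has to vanish. Real and imaginary parts are estimated separately throughout, which accounts
    for the stray factors 2 in the bounds. Orders of germs are bounded below through multipliers: if
    a power of g is the identity, the same power of l is 1. Indices are shifted to avoid
    subtraction: the p of the theorem appears as [S p], and the exponent p+1 as [S (S p)]. *)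

Definition ccont (f : C -> C) (z : C) : Prop :=
  forall eps, 0 < eps -> exists delta, 0 < delta /\
    forall w, Cmod (w - z) < delta -> Cmod (f w - f z) < eps.

Lemma Cmod_minus_sym (z w : C) : Cmod (z - w) = Cmod (w - z).
Proof. rewrite <- Cmod_opp; f_equal; ring. Qed.

Lemma Cmod_triangle_minus (z w : C) : Cmod (z - w) <= Cmod z + Cmod w.
Proof. rewrite <- (Cmod_opp w); apply Cmod_triangle. Qed.

Lemma Cmod_triangle_rev (z w : C) : Cmod z - Cmod w <= Cmod (z - w).
Proof.
  assert (H := Cmod_triangle (z - w) w).
  replace (z - w + w)%C with z in H by ring; lra.
Qed.

Lemma Cmod_minus_diag (z : C) : Cmod (z - z) = 0.
Proof. replace (z - z)%C with (RtoC 0) by ring; apply Cmod_0. Qed.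

Lemma ccont_const (c z : C) : ccont (fun _ => c) z.
Proof.
  intros e He; exists 1; split; [lra|]; intros w _; rewrite Cmod_minus_diag; lra.
Qed.

Lemma ccont_id (z : C) : ccont (fun w => w) z.
Proof. intros e He; exists e; split; auto. Qed.

Lemma ccont_plus (f g : C -> C) (z : C) :
  ccont f z -> ccont g z -> ccont (fun w => f w + g w)%C z.
Proof.
  intros Hf Hg e He.
  destruct (Hf (e/2)) as [d1 [Hd1 H1]]; [lra|].
  destruct (Hg (e/2)) as [d2 [Hd2 H2]]; [lra|].
  exists (Rmin d1 d2); split; [apply Rmin_glb_lt; auto|].
  intros w Hw.
  assert (L1 := H1 w (Rlt_le_trans _ _ _ Hw (Rmin_l _ _))).
  assert (L2 := H2 w (Rlt_le_trans _ _ _ Hw (Rmin_r _ _))).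
  replace (f w + g w - (f z + g z))%C with ((f w - f z) + (g w - g z))%C by ring.
  eapply Rle_lt_trans; [apply Cmod_triangle|lra].
Qed.

Lemma ccont_mult (f g : C -> C) (z : C) :
  ccont f z -> ccont g z -> ccont (fun w => f w * g w)%C z.
Proof.
  intros Hf Hg e He.
  set (A := Cmod (f z) + Cmod (g z) + 1).
  assert (HA : 1 <= A)
    by (unfold A; pose proof (Cmod_ge_0 (f z)); pose proof (Cmod_ge_0 (g z)); lra).
  set (e' := Rmin 1 (e / (2 * A))).
  assert (He' : 0 < e').
  { apply Rmin_glb_lt; [lra|]; apply Rdiv_lt_0_compat; lra. }
  assert (He2 : e' * (2 * A) <= e).
  { apply Rle_trans with (e / (2 * A) * (2 * A)); [|right; field; lra].
    apply Rmult_le_compat_r; [lra|apply Rmin_r]. }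
  assert (He1 : e' <= 1) by apply Rmin_l.
  destruct (Hf e' He') as [d1 [Hd1 H1]].
  destruct (Hg e' He') as [d2 [Hd2 H2]].
  exists (Rmin d1 d2); split; [apply Rmin_glb_lt; auto|].
  intros w Hw.
  assert (L1 := H1 w (Rlt_le_trans _ _ _ Hw (Rmin_l _ _))).
  assert (L2 := H2 w (Rlt_le_trans _ _ _ Hw (Rmin_r _ _))).
  replace (f w * g w - f z * g z)%C
    with ((f w - f z) * (g w - g z) + (f w - f z) * g z + f z * (g w - g z))%C by ring.
  eapply Rle_lt_trans; [apply Cmod_triangle|].
  eapply Rle_lt_trans; [apply Rplus_le_compat_r, Cmod_triangle|].
  rewrite !Cmod_mult.
  pose proof (Cmod_ge_0 (f z)); pose proof (Cmod_ge_0 (g z)).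
  pose proof (Cmod_ge_0 (f w - f z)); pose proof (Cmod_ge_0 (g w - g z)).
  assert (Cmod (f w - f z) * Cmod (g w - g z) <= e' * 1)
    by (apply Rmult_le_compat; lra).
  assert (Cmod (f w - f z) * Cmod (g z) <= e' * Cmod (g z))
    by (apply Rmult_le_compat_r; lra).
  assert (Cmod (f z) * Cmod (g w - g z) <= Cmod (f z) * e')
    by (apply Rmult_le_compat_l; lra).
  unfold A in He2; nra.
Qed.

Lemma ccont_inv (f : C -> C) (z : C) :
  ccont f z -> f z <> 0 -> ccont (fun w => / f w)%C z.
Proof.
  intros Hf Hz e He.
  set (A := Cmod (f z)).
  assert (HA : 0 < A) by (apply Cmod_gt_0; auto).
  set (e' := Rmin (A / 2) (e * (A * A) / 2)).
  assert (He' : 0 < e').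
  { apply Rmin_glb_lt; [lra|]; apply Rdiv_lt_0_compat; [|lra].
    apply Rmult_lt_0_compat; [lra|nra]. }
  assert (E1 : e' <= A / 2) by apply Rmin_l.
  assert (E2 : e' <= e * (A * A) / 2) by apply Rmin_r.
  destruct (Hf e' He') as [d [Hd H]].
  exists d; split; auto; intros w Hw.
  assert (L := H w Hw).
  assert (Hfw : A / 2 < Cmod (f w)).
  { pose proof (Cmod_triangle_rev (f z) (f w)).
    rewrite Cmod_minus_sym in H0; fold A in H0; lra. }
  assert (Hw0 : f w <> 0) by (apply Cmod_gt_0; lra).
  replace (/ f w - / f z)%C with (- ((f w - f z) * / (f w * f z)))%C
    by (field; auto).
  rewrite Cmod_opp, Cmod_mult, Cmod_inv, Cmod_mult by (apply Cmult_neq_0; auto).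
  fold A.
  assert (HB : 0 < Cmod (f w) * A) by (apply Rmult_lt_0_compat; lra).
  apply Rmult_lt_reg_r with (Cmod (f w) * A); auto.
  rewrite Rmult_assoc, Rinv_l, Rmult_1_r by lra.
  eapply Rlt_le_trans; [exact L|].
  eapply Rle_trans; [exact E2|].
  assert (A * A / 2 <= Cmod (f w) * A) by nra.
  replace (e * (A * A) / 2) with (e * (A * A / 2)) by field.
  apply Rmult_le_compat_l; lra.
Qed.

Lemma ccont_comp (f g : C -> C) (z : C) :
  ccont g z -> ccont f (g z) -> ccont (fun w => f (g w)) z.
Proof.
  intros Hg Hf e He.
  destruct (Hf e He) as [d1 [Hd1 H1]].
  destruct (Hg d1 Hd1) as [d2 [Hd2 H2]].
  exists d2; split; auto.
Qed.

Lemma ccont_ext_near (f g : C -> C) (z : C) (d : R) :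
  0 < d -> (forall w, Cmod (w - z) < d -> f w = g w) -> ccont f z -> ccont g z.
Proof.
  intros Hd Hfg Hf e He.
  destruct (Hf e He) as [d1 [Hd1 H1]].
  exists (Rmin d d1); split; [apply Rmin_glb_lt; auto|].
  intros w Hw.
  rewrite <- !Hfg.
  - apply H1; eapply Rlt_le_trans; [exact Hw|apply Rmin_r].
  - rewrite Cmod_minus_diag; auto.
  - eapply Rlt_le_trans; [exact Hw|apply Rmin_l].
Qed.

Lemma cderiv_eps (f : C -> C) (z l : C) :
  cderiv f z l <->
  forall eps, 0 < eps -> exists delta, 0 < delta /\
    forall w, Cmod (w - z) < delta ->
      Cmod (f w - f z - l * (w - z)) <= eps * Cmod (w - z).
Proof.
  split.
  - intros [_ H] e He.
    specialize (H z (fun P HP => HP) (mkposreal e He)).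
    destruct H as [d Hd]; simpl in Hd.
    exists d; split; [apply cond_pos|]; intros w Hw.
    specialize (Hd w).
    specialize (Hd Hw).
    change (Cmod (f w - f z - (w - z) * l) <= e * Cmod (w - z)) in Hd.
    rewrite (Cmult_comm l); exact Hd.
  - intros H; split; [apply is_linear_scal_l|].
    intros x Hx e.
    (* The definition of the derivative quantifies over every limit [x] of the neighbourhood filter
       of [z]; separation leaves only [z] itself. *)
    apply (is_filter_lim_locally_unique (V := AbsRing_NormedModule C_AbsRing)) in Hx; subst x.
    destruct (H e (cond_pos e)) as [d [Hd Hw]].
    exists (mkposreal _ Hd); intros w Hlt.
    specialize (Hw w Hlt).
    change (Cmod (f w - f z - (w - z) * l) <= e * Cmod (w - z)).
    rewrite (Cmult_comm (w - z)); exact Hw.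
Qed.

(** Through a factor [phi] that is continuous at [z], the sum, product and chain rules reduce to
    rules for continuous functions. The factor is the difference quotient, completed by [l] at [z]
    through a classical case distinction. *)
Lemma cderiv_caratheodory (f : C -> C) (z l : C) :
  cderiv f z l <->
  exists phi : C -> C, ccont phi z /\ phi z = l /\
    forall w, (f w = f z + phi w * (w - z))%C.
Proof.
  rewrite cderiv_eps; split.
  - intros H.
    exists (fun w => if excluded_middle_informative (w = z) then l
                     else ((f w - f z) / (w - z))%C).
    split; [|split].
    + intros e He.
      destruct (H (e/2)) as [d [Hd Hw]]; [lra|].
      exists d; split; auto; intros w Hwd.
      destruct (excluded_middle_informative (z = z)); [|congruence].
      destruct (excluded_middle_informative (w = z)) as [E|E].
      * rewrite Cmod_minus_diag; lra.
      * assert (N : (w - z)%C <> 0) by (apply Cminus_eq_contra; auto).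
        assert (Np := proj1 (Cmod_gt_0 _) N).
        replace ((f w - f z) / (w - z) - l)%C
          with ((f w - f z - l * (w - z)) / (w - z))%C by (field; auto).
        rewrite Cmod_div by auto.
        specialize (Hw w Hwd).
        apply Rle_lt_trans with (e / 2); [|lra].
        apply Rmult_le_reg_r with (Cmod (w - z)); auto.
        unfold Rdiv; rewrite Rmult_assoc, Rinv_l by lra.
        rewrite Rmult_1_r; exact Hw.
    + destruct (excluded_middle_informative (z = z)); congruence.
    + intros w; destruct (excluded_middle_informative (w = z)) as [E|E].
      * subst; ring.
      * field; apply Cminus_eq_contra; auto.
  - intros [phi [Hc [Hz Hf]]] e He.
    destruct (Hc e He) as [d [Hd Hw]].
    exists d; split; auto; intros w Hwd.
    rewrite (Hf w).
    replace (f z + phi w * (w - z) - f z - l * (w - z))%C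
      with ((phi w - phi z) * (w - z))%C by (rewrite Hz; ring).
    rewrite Cmod_mult; apply Rmult_le_compat_r; [apply Cmod_ge_0|].
    apply Rlt_le; auto.
Qed.

Lemma cderiv_ccont (f : C -> C) (z l : C) : cderiv f z l -> ccont f z.
Proof.
  rewrite cderiv_caratheodory; intros [phi [Hc [_ Hf]]].
  apply (ccont_ext_near (fun w => f z + phi w * (w + - z))%C _ _ 1); [lra| |].
  - intros w _; rewrite (Hf w); ring.
  - apply ccont_plus; [apply ccont_const|].
    apply ccont_mult; auto.
    apply ccont_plus; [apply ccont_id|apply ccont_const].
Qed.

Lemma cderiv_const (c z : C) : cderiv (fun _ => c) z 0.
Proof.
  apply cderiv_caratheodory; exists (fun _ => RtoC 0).
  split; [apply ccont_const|split; auto]; intros w; ring.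
Qed.

Lemma cderiv_id (z : C) : cderiv (fun w => w) z 1.
Proof.
  apply cderiv_caratheodory; exists (fun _ => RtoC 1).
  split; [apply ccont_const|split; auto]; intros w; ring.
Qed.

Lemma cderiv_plus (f g : C -> C) (z lf lg : C) :
  cderiv f z lf -> cderiv g z lg -> cderiv (fun w => f w + g w)%C z (lf + lg).
Proof.
  rewrite !cderiv_caratheodory; intros [p [Hp [Pz Pf]]] [q [Hq [Qz Qf]]].
  exists (fun w => p w + q w)%C; split; [apply ccont_plus; auto|split].
  - now rewrite Pz, Qz.
  - intros w; rewrite (Pf w), (Qf w); ring.
Qed.

Lemma cderiv_mult (f g : C -> C) (z lf lg : C) :
  cderiv f z lf -> cderiv g z lg ->
  cderiv (fun w => f w * g w)%C z (lf * g z + f z * lg).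
Proof.
  intros Df Dg; assert (Cg := cderiv_ccont _ _ _ Dg); revert Df Dg.
  rewrite !cderiv_caratheodory; intros [p [Hp [Pz Pf]]] [q [Hq [Qz Qf]]].
  exists (fun w => p w * g w + f z * q w)%C; split; [|split].
  - apply ccont_plus; apply ccont_mult; auto; apply ccont_const.
  - now rewrite Pz, Qz.
  - intros w; rewrite (Pf w).
    replace ((f z + p w * (w - z)) * g w)%C
      with (f z * g w + p w * g w * (w - z))%C by ring.
    rewrite (Qf w) at 1; ring.
Qed.

Lemma cderiv_opp (f : C -> C) (z l : C) :
  cderiv f z l -> cderiv (fun w => - f w)%C z (- l).
Proof.
  rewrite !cderiv_caratheodory; intros [p [Hp [Pz Pf]]].
  exists (fun w => - (1) * p w)%C; split; [|split].
  - apply ccont_mult; [apply ccont_const|auto].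
  - rewrite Pz; ring.
  - intros w; rewrite (Pf w); ring.
Qed.

Lemma cderiv_minus (f g : C -> C) (z lf lg : C) :
  cderiv f z lf -> cderiv g z lg -> cderiv (fun w => f w - g w)%C z (lf - lg).
Proof. intros; apply cderiv_plus; [auto|apply cderiv_opp; auto]. Qed.

(** The explicit quotient [- p w / (f w * f z)] is available only where [f] does not vanish, so the
    estimate is made on a disc around [z] instead of through the global factorisation. *)
Lemma cderiv_inv (f : C -> C) (z l : C) :
  cderiv f z l -> f z <> 0 -> exists l', cderiv (fun w => / f w)%C z l'.
Proof.
  intros Df Hz; assert (Cf := cderiv_ccont _ _ _ Df); revert Df.
  rewrite cderiv_caratheodory; intros [p [Hp [Pz Pf]]].
  destruct (Cf (Cmod (f z))) as [d [Hd Hw]]; [apply Cmod_gt_0; auto|].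
  assert (N : forall w, Cmod (w - z) < d -> f w <> 0).
  { intros w H E; specialize (Hw w H); rewrite E in Hw.
    replace (0 - f z)%C with (- f z)%C in Hw by ring.
    rewrite Cmod_opp in Hw; lra. }
  exists (- p z * / (f z * f z))%C.
  apply cderiv_eps; intros e He.
  assert (Q : ccont (fun w => - (1) * p w * / (f w * f z))%C z).
  { apply ccont_mult.
    - apply ccont_mult; [apply ccont_const|auto].
    - apply ccont_inv.
      + apply ccont_mult; [auto|apply ccont_const].
      + apply Cmult_neq_0; auto. }
  destruct (Q e He) as [d' [Hd' H']].
  exists (Rmin d d'); split; [apply Rmin_glb_lt; auto|]; intros w Hwd.
  assert (Hw1 : Cmod (w - z) < d) by (eapply Rlt_le_trans; [exact Hwd|apply Rmin_l]).
  assert (Hw2 : Cmod (w - z) < d') by (eapply Rlt_le_trans; [exact Hwd|apply Rmin_r]).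
  specialize (H' w Hw2).
  assert (Nw := N w Hw1).
  replace (/ f w - / f z - - p z * / (f z * f z) * (w - z))%C
    with ((- (1) * p w * / (f w * f z) - - (1) * p z * / (f z * f z)) * (w - z))%C.
  - rewrite Cmod_mult; apply Rmult_le_compat_r; [apply Cmod_ge_0|lra].
  - replace (/ f w - / f z)%C with (- (f w - f z) * / (f w * f z))%C
      by (field; auto).
    replace (- (f w - f z))%C with (- (1) * p w * (w - z))%C.
    + ring.
    + rewrite (Pf w); ring.
Qed.

Lemma cderiv_comp (f g : C -> C) (z lf lg : C) :
  cderiv g z lg -> cderiv f (g z) lf -> cderiv (fun w => f (g w)) z (lf * lg).
Proof.
  intros Dg; assert (Cg := cderiv_ccont _ _ _ Dg); revert Dg.
  rewrite !cderiv_caratheodory; intros [q [Hq [Qz Qf]]] [p [Hp [Pz Pf]]].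
  exists (fun w => p (g w) * q w)%C; split; [|split].
  - apply ccont_mult; auto; apply (ccont_comp p g); auto.
  - now rewrite Pz, Qz.
  - intros w; rewrite (Pf (g w)).
    replace (g w - g z)%C with (q w * (w - z))%C; [ring|rewrite (Qf w); ring].
Qed.

Lemma cderiv_ext_near (f g : C -> C) (z l : C) (d : R) :
  0 < d -> (forall w, Cmod (w - z) < d -> f w = g w) -> cderiv f z l -> cderiv g z l.
Proof.
  intros Hd Hfg; rewrite !cderiv_eps; intros Hf e He.
  destruct (Hf e He) as [d1 [Hd1 H1]].
  exists (Rmin d d1); split; [apply Rmin_glb_lt; auto|].
  intros w Hw.
  rewrite <- !Hfg.
  - apply H1; eapply Rlt_le_trans; [exact Hw|apply Rmin_r].
  - rewrite Cmod_minus_diag; auto.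
  - eapply Rlt_le_trans; [exact Hw|apply Rmin_l].
Qed.

Lemma cderiv_unique (f : C -> C) (z l1 l2 : C) :
  cderiv f z l1 -> cderiv f z l2 -> l1 = l2.
Proof.
  intros H1 H2.
  apply is_C_derive_unique in H1; apply is_C_derive_unique in H2; congruence.
Qed.

Definition cdiff (f : C -> C) (z : C) : Prop := exists l, cderiv f z l.

(** * Goursat's theorem on rectangles *)

Definition rcont (f : R -> C) (t : R) : Prop :=
  forall eps, 0 < eps -> exists delta, 0 < delta /\
    forall u, Rabs (u - t) < delta -> Cmod (f u - f t) < eps.

Lemma rcont_comp (phi : C -> C) (g : R -> C) (t : R) :
  rcont g t -> ccont phi (g t) -> rcont (fun u => phi (g u)) t.
Proof.
  intros Hg Hf e He.
  destruct (Hf e He) as [d1 [Hd1 H1]].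
  destruct (Hg d1 Hd1) as [d2 [Hd2 H2]].
  exists d2; split; auto.
Qed.

Lemma rcont_re (f : R -> C) (t : R) : rcont f t -> continuous (fun u => fst (f u)) t.
Proof.
  intros H P [e He].
  destruct (H e (cond_pos e)) as [d [Hd Hu]].
  exists (mkposreal d Hd); intros u B; apply He.
  change (Rabs (fst (f u) - fst (f t)) < e).
  apply Rle_lt_trans with (Cmod (f u - f t)); [|apply Hu; exact B].
  exact (re_le_Cmod (f u - f t)).
Qed.

Lemma im_le_Cmod (z : C) : Rabs (snd z) <= Cmod z.
Proof. eapply Rle_trans; [apply Rmax_r|apply Rmax_Cmod]. Qed.

Lemma rcont_im (f : R -> C) (t : R) : rcont f t -> continuous (fun u => snd (f u)) t.
Proof.
  intros H P [e He].
  destruct (H e (cond_pos e)) as [d [Hd Hu]].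
  exists (mkposreal d Hd); intros u B; apply He.
  change (Rabs (snd (f u) - snd (f t)) < e).
  apply Rle_lt_trans with (Cmod (f u - f t)); [|apply Hu; exact B].
  exact (im_le_Cmod (f u - f t)).
Qed.

Lemma Cmod_le_abs (z : C) : Cmod z <= Rabs (fst z) + Rabs (snd z).
Proof.
  destruct z as [x y]; simpl.
  replace (x, y) with (RtoC x + Ci * RtoC y)%C
    by (unfold Cplus, Cmult, Ci, RtoC; simpl; f_equal; ring).
  eapply Rle_trans; [apply Cmod_triangle|].
  rewrite Cmod_mult, Cmod_Ci, !Cmod_R; lra.
Qed.

Lemma rcont_pair (f : R -> C) (t : R) :
  continuous (fun u => fst (f u)) t -> continuous (fun u => snd (f u)) t -> rcont f t.
Proof.
  intros H1 H2 e He.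
  assert (He2 : 0 < e / 2) by lra.
  destruct (H1 (ball (fst (f t)) (mkposreal _ He2))) as [d1 B1]; [apply locally_ball|].
  destruct (H2 (ball (snd (f t)) (mkposreal _ He2))) as [d2 B2]; [apply locally_ball|].
  exists (Rmin d1 d2); split; [apply Rmin_glb_lt; apply cond_pos|].
  intros u Hu.
  assert (L1 := B1 u (Rlt_le_trans _ _ _ Hu (Rmin_l _ _))).
  assert (L2 := B2 u (Rlt_le_trans _ _ _ Hu (Rmin_r _ _))).
  change (Rabs (fst (f u) - fst (f t)) < e / 2) in L1.
  change (Rabs (snd (f u) - snd (f t)) < e / 2) in L2.
  eapply Rle_lt_trans; [apply Cmod_le_abs|].
  change (Rabs (fst (f u) - fst (f t)) + Rabs (snd (f u) - snd (f t)) < e); lra.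
Qed.

(** Taken componentwise, so that real integration theory applies directly. The price is the factor 2
    in [CI_bound], harmless because every later estimate has a free constant in front. *)
Definition CI (f : R -> C) (a b : R) : C :=
  (RInt (fun t => fst (f t)) a b, RInt (fun t => snd (f t)) a b).

Definition rcont_on (f : R -> C) (a b : R) : Prop :=
  forall t, a <= t <= b -> rcont f t.

Lemma rcont_on_ex_re (f : R -> C) (a b : R) :
  a <= b -> rcont_on f a b -> ex_RInt (fun t => fst (f t)) a b.
Proof.
  intros Hab H; apply (ex_RInt_continuous (V := R_CompleteNormedModule)); intros z Hz.
  rewrite Rmin_left, Rmax_right in Hz by auto; apply rcont_re; auto.
Qed.

Lemma rcont_on_ex_im (f : R -> C) (a b : R) :
  a <= b -> rcont_on f a b -> ex_RInt (fun t => snd (f t)) a b.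
Proof.
  intros Hab H; apply (ex_RInt_continuous (V := R_CompleteNormedModule)); intros z Hz.
  rewrite Rmin_left, Rmax_right in Hz by auto; apply rcont_im; auto.
Qed.

Lemma CI_ext (f g : R -> C) (a b : R) :
  a <= b -> (forall t, a <= t <= b -> f t = g t) -> CI f a b = CI g a b.
Proof.
  intros Hab H; unfold CI; f_equal; apply RInt_ext; intros x Hx;
  rewrite Rmin_left, Rmax_right in Hx by auto; rewrite H by lra; auto.
Qed.

Lemma CI_plus (f g : R -> C) (a b : R) :
  a <= b -> rcont_on f a b -> rcont_on g a b ->
  CI (fun t => f t + g t)%C a b = (CI f a b + CI g a b)%C.
Proof.
  intros Hab Hf Hg; unfold CI, Cplus; simpl; f_equal.
  - apply (RInt_plus (V := R_CompleteNormedModule)); apply rcont_on_ex_re; auto.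
  - apply (RInt_plus (V := R_CompleteNormedModule)); apply rcont_on_ex_im; auto.
Qed.

Lemma CI_scal (k : C) (f : R -> C) (a b : R) :
  a <= b -> rcont_on f a b -> CI (fun t => k * f t)%C a b = (k * CI f a b)%C.
Proof.
  intros Hab Hf; destruct k as [u v]; unfold CI, Cmult; simpl.
  assert (E1 := rcont_on_ex_re f a b Hab Hf).
  assert (E2 := rcont_on_ex_im f a b Hab Hf).
  assert (S1 : forall l, RInt (fun t => l * fst (f t)) a b
                    = l * RInt (fun t => fst (f t)) a b)
    by (intros l; apply (RInt_scal (V := R_CompleteNormedModule)); auto).
  assert (S2 : forall l, RInt (fun t => l * snd (f t)) a b
                    = l * RInt (fun t => snd (f t)) a b)
    by (intros l; apply (RInt_scal (V := R_CompleteNormedModule)); auto).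
  assert (X1 : forall l, ex_RInt (fun t => l * fst (f t)) a b)
    by (intros l; apply (ex_RInt_scal (V := R_NormedModule)); auto).
  assert (X2 : forall l, ex_RInt (fun t => l * snd (f t)) a b)
    by (intros l; apply (ex_RInt_scal (V := R_NormedModule)); auto).
  f_equal.
  - rewrite <- S1, <- S2.
    apply (RInt_minus (V := R_CompleteNormedModule)); auto.
  - rewrite <- S1, <- S2.
    apply (RInt_plus (V := R_CompleteNormedModule)); auto.
Qed.

Lemma rcont_scal (k : C) (f : R -> C) (t : R) :
  rcont f t -> rcont (fun u => k * f u)%C t.
Proof.
  intros Hf; apply (rcont_comp (fun w => k * w)%C); auto.
  apply ccont_mult; [apply ccont_const|apply ccont_id].
Qed.

Lemma CI_minus (f g : R -> C) (a b : R) :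
  a <= b -> rcont_on f a b -> rcont_on g a b ->
  CI (fun t => f t - g t)%C a b = (CI f a b - CI g a b)%C.
Proof.
  intros Hab Hf Hg.
  rewrite (CI_ext _ (fun t => f t + - (1) * g t)%C) by (auto; intros; ring).
  rewrite CI_plus, CI_scal; auto; [ring|].
  intros t Ht; apply rcont_scal; auto.
Qed.

Lemma CI_Chasles (f : R -> C) (a b c : R) :
  a <= b -> b <= c -> rcont_on f a c -> (CI f a b + CI f b c)%C = CI f a c.
Proof.
  intros Hab Hbc H; unfold CI, Cplus; simpl.
  assert (Ha : rcont_on f a b) by (intros t Ht; apply H; lra).
  assert (Hb : rcont_on f b c) by (intros t Ht; apply H; lra).
  f_equal.
  - exact (RInt_Chasles (V := R_CompleteNormedModule) _ a b c
      (rcont_on_ex_re f a b Hab Ha) (rcont_on_ex_re f b c Hbc Hb)).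
  - exact (RInt_Chasles (V := R_CompleteNormedModule) _ a b c
      (rcont_on_ex_im f a b Hab Ha) (rcont_on_ex_im f b c Hbc Hb)).
Qed.

Lemma CI_const (k : C) (a b : R) : CI (fun _ => k) a b = (RtoC (b - a) * k)%C.
Proof.
  unfold CI; rewrite !RInt_const; unfold scal; simpl; unfold mult; simpl.
  destruct k as [x y]; unfold RtoC, Cmult; simpl; f_equal; ring.
Qed.

Lemma CI_bound (f : R -> C) (a b B : R) :
  a <= b -> rcont_on f a b -> (forall t, a <= t <= b -> Cmod (f t) <= B) ->
  Cmod (CI f a b) <= 2 * B * (b - a).
Proof.
  intros Hab Hf HB.
  eapply Rle_trans; [apply Cmod_le_abs|]; simpl.
  assert (H1 : Rabs (RInt (fun t => fst (f t)) a b) <= (b - a) * B).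
  { apply abs_RInt_le_const; auto; [apply rcont_on_ex_re; auto|].
    intros t Ht; eapply Rle_trans; [|apply (HB t Ht)]; exact (re_le_Cmod (f t)). }
  assert (H2 : Rabs (RInt (fun t => snd (f t)) a b) <= (b - a) * B).
  { apply abs_RInt_le_const; auto; [apply rcont_on_ex_im; auto|].
    intros t Ht; eapply Rle_trans; [|apply (HB t Ht)]; exact (im_le_Cmod (f t)). }
  lra.
Qed.

(** The integral of [Q(z) dz] counterclockwise along the boundary of the rectangle [[a,b] x [c,d]];
    [Ci] is dz/dy on the vertical sides. *)
Definition RI (Q : C -> C) (a b c d : R) : C :=
  (CI (fun x => Q (x, c)) a b - CI (fun x => Q (x, d)) a b
   + Ci * (CI (fun y => Q (b, y)) c d - CI (fun y => Q (a, y)) c d))%C.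

Definition ccont_rect (Q : C -> C) (a b c d : R) : Prop :=
  forall x y, a <= x <= b -> c <= y <= d -> ccont Q (x, y).

Lemma rcont_horizontal (Q : C -> C) (x y : R) :
  ccont Q (x, y) -> rcont (fun t => Q (t, y)) x.
Proof.
  intros H; apply (rcont_comp Q (fun t => (t, y))); auto.
  apply rcont_pair; simpl; [apply continuous_id|apply continuous_const].
Qed.

Lemma rcont_vertical (Q : C -> C) (x y : R) :
  ccont Q (x, y) -> rcont (fun t => Q (x, t)) y.
Proof.
  intros H; apply (rcont_comp Q (fun t => (x, t))); auto.
  apply rcont_pair; simpl; [apply continuous_const|apply continuous_id].
Qed.

Ltac rect_cont :=
  match goal with
  | H : ccont_rect ?Q _ _ _ _ |- rcont_on (fun t => ?Q (t, _)) _ _ =>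
      intros ? ?; apply rcont_horizontal; apply H; lra
  | H : ccont_rect ?Q _ _ _ _ |- rcont_on (fun t => ?Q (_, t)) _ _ =>
      intros ? ?; apply rcont_vertical; apply H; lra
  end.

Lemma RI_plus (P Q : C -> C) (a b c d : R) :
  a <= b -> c <= d -> ccont_rect P a b c d -> ccont_rect Q a b c d ->
  RI (fun z => P z + Q z)%C a b c d = (RI P a b c d + RI Q a b c d)%C.
Proof.
  intros Hab Hcd HP HQ; unfold RI.
  rewrite 4!CI_plus by (auto; rect_cont); ring.
Qed.

Lemma RI_scal (k : C) (Q : C -> C) (a b c d : R) :
  a <= b -> c <= d -> ccont_rect Q a b c d ->
  RI (fun z => k * Q z)%C a b c d = (k * RI Q a b c d)%C.
Proof.
  intros Hab Hcd HQ; unfold RI.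
  rewrite 4!CI_scal by (auto; rect_cont); ring.
Qed.

Lemma RInt_id (a b : R) : RInt (fun t => t) a b = (b * b - a * a) / 2.
Proof.
  apply is_RInt_unique.
  replace ((b * b - a * a) / 2) with (minus (b * b / 2) (a * a / 2))
    by (unfold minus, plus, opp; simpl; field).
  apply (is_RInt_derive (fun t => t * t / 2)); intros.
  - auto_derive; auto; field.
  - apply continuous_id.
Qed.

Lemma RI_const (k : C) (a b c d : R) : RI (fun _ => k) a b c d = 0.
Proof. unfold RI; rewrite !CI_const; ring. Qed.

Lemma RI_id (a b c d : R) : RI (fun z => z) a b c d = 0.
Proof.
  unfold RI, CI; simpl; rewrite !RInt_const, !RInt_id.
  unfold scal; simpl; unfold mult; simpl.
  unfold Cplus, Cminus, Cmult, Copp, Ci, RtoC; simpl; f_equal; field.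
Qed.

(** Affine functions have primitives, so they contribute nothing to a closed contour. Goursat's
    argument uses this to remove the first-order Taylor polynomial at the limit point. *)
Lemma RI_minus_affine (Q : C -> C) (k l : C) (a b c d : R) :
  a <= b -> c <= d -> ccont_rect Q a b c d ->
  RI (fun z => Q z + (k + l * z))%C a b c d = RI Q a b c d.
Proof.
  intros Hab Hcd HQ.
  assert (Hc : ccont_rect (fun _ => k) a b c d) by (intros x y _ _; apply ccont_const).
  assert (Hi : ccont_rect (fun z => z) a b c d) by (intros x y _ _; apply ccont_id).
  assert (Hl : ccont_rect (fun z => l * z)%C a b c d)
    by (intros x y _ _; apply ccont_mult; [apply ccont_const|apply ccont_id]).
  assert (Ha : ccont_rect (fun z => k + l * z)%C a b c d)
    by (intros x y Hx Hy; apply ccont_plus; auto).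
  rewrite !RI_plus, RI_scal, RI_const, RI_id by auto; ring.
Qed.

Lemma RI_bound (Q : C -> C) (a b c d B : R) :
  a <= b -> c <= d -> ccont_rect Q a b c d ->
  (forall x y, a <= x <= b -> c <= y <= d -> Cmod (Q (x, y)) <= B) ->
  Cmod (RI Q a b c d) <= 4 * B * ((b - a) + (d - c)).
Proof.
  intros Hab Hcd HQ HB; unfold RI.
  assert (B1 : Cmod (CI (fun x => Q (x, c)) a b) <= 2 * B * (b - a))
    by (apply CI_bound; [auto|rect_cont|intros; apply HB; lra]).
  assert (B2 : Cmod (CI (fun x => Q (x, d)) a b) <= 2 * B * (b - a))
    by (apply CI_bound; [auto|rect_cont|intros; apply HB; lra]).
  assert (B3 : Cmod (CI (fun y => Q (b, y)) c d) <= 2 * B * (d - c))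
    by (apply CI_bound; [auto|rect_cont|intros; apply HB; lra]).
  assert (B4 : Cmod (CI (fun y => Q (a, y)) c d) <= 2 * B * (d - c))
    by (apply CI_bound; [auto|rect_cont|intros; apply HB; lra]).
  eapply Rle_trans; [apply Cmod_triangle|].
  rewrite Cmod_mult, Cmod_Ci.
  pose proof (Cmod_triangle_minus (CI (fun x => Q (x, c)) a b) (CI (fun x => Q (x, d)) a b)).
  pose proof (Cmod_triangle_minus (CI (fun y => Q (b, y)) c d) (CI (fun y => Q (a, y)) c d)).
  lra.
Qed.

Lemma RI_quarter (Q : C -> C) (a m b c n d : R) :
  a <= m <= b -> c <= n <= d -> ccont_rect Q a b c d ->
  RI Q a b c d =
    (RI Q a m c n + RI Q m b c n + RI Q a m n d + RI Q m b n d)%C.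
Proof.
  intros Hm Hn HQ; unfold RI.
  rewrite <- (CI_Chasles (fun x => Q (x, c)) a m b) by (try lra; rect_cont).
  rewrite <- (CI_Chasles (fun x => Q (x, d)) a m b) by (try lra; rect_cont).
  rewrite <- (CI_Chasles (fun y => Q (b, y)) c n d) by (try lra; rect_cont).
  rewrite <- (CI_Chasles (fun y => Q (a, y)) c n d) by (try lra; rect_cont).
  ring.
Qed.

(** The supremum of the left endpoints works: they increase, while the right endpoints
    [x k + w / 2 ^ k] decrease. *)
Lemma bisection_limit (x : nat -> R) (w : R) :
  0 <= w ->
  (forall k, x (S k) = x k \/ x (S k) = x k + w / 2 ^ S k) ->
  exists x0, forall k, x k <= x0 <= x k + w / 2 ^ k.
Proof.
  intros Hw Hx.
  assert (Hp : forall k, 0 < 2 ^ k) by (intros; apply pow_lt; lra).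
  assert (Hq : forall k, 0 <= w / 2 ^ k)
    by (intros; apply Rmult_le_pos; [auto|apply Rlt_le, Rinv_0_lt_compat, Hp]).
  assert (Hs : forall k, w / 2 ^ k = w / 2 ^ S k + w / 2 ^ S k)
    by (intros k; simpl; field; specialize (Hp k); lra).
  assert (Inc : forall k j, x k <= x (j + k)%nat).
  { intros k j; induction j as [|j IH]; simpl; [lra|].
    pose proof (Hq (S (j + k))); destruct (Hx (j + k)%nat); lra. }
  assert (Dec : forall k j, x (j + k)%nat + w / 2 ^ (j + k) <= x k + w / 2 ^ k).
  { intros k j; induction j as [|j IH]; [simpl; lra|].
    change (S j + k)%nat with (S (j + k)).
    pose proof (Hs (j + k)%nat); pose proof (Hq (S (j + k)));
      destruct (Hx (j + k)%nat); lra. }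
  assert (Ub : forall k j, x j <= x k + w / 2 ^ k).
  { intros k j; destruct (Nat.le_ge_cases k j) as [L|L].
    - replace j with ((j - k) + k)%nat by lia.
      pose proof (Dec k (j - k)%nat); pose proof (Hq (j - k + k)%nat); lra.
    - replace k with ((k - j) + j)%nat by lia.
      pose proof (Inc j (k - j)%nat); pose proof (Hq (k - j + j)%nat); lra. }
  destruct (completeness (fun r => exists k, r = x k)) as [x0 [U L]].
  - exists (x O + w / 2 ^ 0); intros r [k ->]; apply Ub.
  - exists (x O); exists O; auto.
  - exists x0; intros k; split.
    + apply U; exists k; auto.
    + apply L; intros r [j ->]; apply Ub.
Qed.

Lemma nested_rectangles (P : nat -> R -> R -> Prop) (a c w h : R) :
  0 <= w -> 0 <= h -> P O a c ->
  (forall k x y, P k x y -> exists x' y',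
     (x' = x \/ x' = x + w / 2 ^ S k) /\ (y' = y \/ y' = y + h / 2 ^ S k) /\
     P (S k) x' y') ->
  exists x0 y0, forall k, exists x y, P k x y /\
    x <= x0 <= x + w / 2 ^ k /\ y <= y0 <= y + h / 2 ^ k.
Proof.
  intros Hw Hh H0 Hstep.
  (* The step is made total by asking nothing when [P] fails, so that a choice function can be
     iterated on plain pairs of reals. *)
  assert (St : forall (k : nat) (p : R * R), exists p' : R * R,
    P k (fst p) (snd p) ->
    (fst p' = fst p \/ fst p' = fst p + w / 2 ^ S k) /\
    (snd p' = snd p \/ snd p' = snd p + h / 2 ^ S k) /\
    P (S k) (fst p') (snd p')).
  { intros k [x y]; destruct (classic (P k x y)) as [HP|HP].
    - destruct (Hstep k x y HP) as [x' [y' H]]; exists (x', y'); auto.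
    - exists (x, y); simpl; intros; contradiction. }
  set (nxt := fun k p => proj1_sig (constructive_indefinite_description _ (St k p))).
  assert (Hn : forall k p, P k (fst p) (snd p) ->
    (fst (nxt k p) = fst p \/ fst (nxt k p) = fst p + w / 2 ^ S k) /\
    (snd (nxt k p) = snd p \/ snd (nxt k p) = snd p + h / 2 ^ S k) /\
    P (S k) (fst (nxt k p)) (snd (nxt k p)))
    by (intros k p; exact (proj2_sig (constructive_indefinite_description _ (St k p)))).
  clearbody nxt.
  set (s := nat_rect (fun _ => (R * R)%type) (a, c) nxt).
  assert (Hs : forall k, P k (fst (s k)) (snd (s k)))
    by (intros k; induction k as [|k IH]; [exact H0|exact (proj2 (proj2 (Hn k _ IH)))]).
  destruct (bisection_limit (fun k => fst (s k)) w Hw) as [x0 Hx].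
  { intros k; exact (proj1 (Hn k _ (Hs k))). }
  destruct (bisection_limit (fun k => snd (s k)) h Hh) as [y0 Hy].
  { intros k; exact (proj1 (proj2 (Hn k _ (Hs k)))). }
  exists x0, y0; intros k; exists (fst (s k)), (snd (s k)); auto.
Qed.

Lemma Goursat_rectangle (Q : C -> C) (a b c d : R) :
  a <= b -> c <= d ->
  (forall x y, a <= x <= b -> c <= y <= d -> cdiff Q (x, y)) ->
  RI Q a b c d = 0.
Proof.
  intros Hab Hcd HD.
  assert (HQ : ccont_rect Q a b c d)
    by (intros x y Hx Hy; destruct (HD x y Hx Hy) as [l Hl]; eapply cderiv_ccont; eauto).
  set (w := b - a); set (h := d - c).
  assert (Hw : 0 <= w) by (unfold w; lra).
  assert (Hh : 0 <= h) by (unfold h; lra).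
  assert (Hp : forall k, 0 < 2 ^ k) by (intros; apply pow_lt; lra).
  assert (Hq : forall v k, 0 <= v -> 0 <= v / 2 ^ k)
    by (intros; apply Rmult_le_pos; [auto|apply Rlt_le, Rinv_0_lt_compat, Hp]).
  assert (Hs : forall v k, v / 2 ^ k = v / 2 ^ S k + v / 2 ^ S k)
    by (intros v k; simpl; field; specialize (Hp k); lra).
  apply Cmod_eq_0; apply Rle_antisym; [|apply Cmod_ge_0].
  apply le_epsilon; intros e He; rewrite Rplus_0_l.
  (* With this [K] the threshold for the full rectangle is at most [e]; the added 1 keeps the
     denominator positive for degenerate rectangles. *)
  set (K := e / ((w + h + 1) * (w + h + 1))).
  assert (HWH : 0 < (w + h + 1) * (w + h + 1)) by nra.
  assert (HK : 0 < K) by (apply Rdiv_lt_0_compat; auto).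
  set (W := fun k => w / 2 ^ k + h / 2 ^ k).
  assert (HW0 : forall k, 0 <= W k)
    by (intros k; pose proof (Hq w k Hw); pose proof (Hq h k Hh); unfold W; lra).
  assert (HWS : forall k, W k = 2 * W (S k))
    by (intros k; unfold W; rewrite (Hs w k), (Hs h k); ring).
  (* The side sum [W k] halves at each step, so the threshold drops to a quarter: if all four
     quarters stayed below the new threshold, their parent would stay below the old one. *)
  set (P := fun k x y => a <= x /\ x + w / 2 ^ k <= b /\ c <= y /\ y + h / 2 ^ k <= d /\
     K * (W k * W k) < Cmod (RI Q x (x + w / 2 ^ k) y (y + h / 2 ^ k))).
  apply Rnot_lt_le; intros Hbig.
  destruct (nested_rectangles P a c w h Hw Hh) as [x0 [y0 Hn]].
  - unfold P, W; simpl; unfold Rdiv; rewrite Rinv_1, !Rmult_1_r.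
    replace (a + w) with b by (unfold w; ring).
    replace (c + h) with d by (unfold h; ring).
    repeat split; try lra.
    eapply Rle_lt_trans; [|exact Hbig].
    apply Rle_trans with (K * ((w + h + 1) * (w + h + 1)));
      [|right; unfold K; field; lra].
    apply Rmult_le_compat_l; nra.
  - intros k x y [H1 [H2 [H3 [H4 H5]]]].
    pose proof (Hq w (S k) Hw); pose proof (Hq h (S k) Hh).
    pose proof (Hs w k); pose proof (Hs h k).
    set (w' := w / 2 ^ S k) in *; set (h' := h / 2 ^ S k) in *.
    apply NNPP; intros Hno.
    assert (Small : forall x' y', (x' = x \/ x' = x + w') -> (y' = y \/ y' = y + h') ->
      Cmod (RI Q x' (x' + w') y' (y' + h')) <= K * (W (S k) * W (S k))).
    { intros x' y' Hx' Hy'; apply Rnot_lt_le; intros Hl; apply Hno.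
      exists x', y'; repeat split; auto; fold w' h'; try lra;
      destruct Hx', Hy'; lra. }
    apply (Rlt_not_le _ _ H5).
    rewrite (RI_quarter Q x (x + w') _ y (y + h'));
      [|lra|lra|intros u v Hu Hv; apply HQ; lra].
    replace (x + w / 2 ^ k) with (x + w' + w') by lra.
    replace (y + h / 2 ^ k) with (y + h' + h') by lra.
    eapply Rle_trans; [apply Cmod_triangle|].
    eapply Rle_trans; [apply Rplus_le_compat_r, Cmod_triangle|].
    eapply Rle_trans; [apply Rplus_le_compat_r, Rplus_le_compat_r, Cmod_triangle|].
    pose proof (Small x y (or_introl eq_refl) (or_introl eq_refl)).
    pose proof (Small (x + w') y (or_intror eq_refl) (or_introl eq_refl)).
    pose proof (Small x (y + h') (or_introl eq_refl) (or_intror eq_refl)).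
    pose proof (Small (x + w') (y + h') (or_intror eq_refl) (or_intror eq_refl)).
    rewrite (HWS k); nra.
  - assert (In0 : a <= x0 <= b /\ c <= y0 <= d).
    { destruct (Hn O) as [x [y [[H1 [H2 [H3 [H4 _]]]] [Hx Hy]]]]; lra. }
    destruct (HD x0 y0 (proj1 In0) (proj2 In0)) as [l Hl].
    (* The 4 cancels the constant of [RI_bound]: an affine approximation with error [K / 4 * W k] on
       a rectangle of side sum [W k] gives exactly the threshold [K * (W k * W k)], a
       contradiction. *)
    destruct (proj1 (cderiv_eps _ _ _) Hl (K / 4)) as [del [Hdel Hd]]; [lra|].
    assert (Hk : exists k, W k < del).
    { destruct (pow_lt_1_zero (1/2)) with (y := del / (w + h + 1)) as [N HN].
      - rewrite Rabs_pos_eq; lra.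
      - apply Rdiv_lt_0_compat; lra.
      - exists N; specialize (HN N (le_n N)).
        rewrite Rabs_pos_eq in HN by (apply pow_le; lra).
        unfold W.
        replace (w / 2 ^ N + h / 2 ^ N) with ((w + h) * (1 / 2) ^ N).
        + apply Rle_lt_trans with ((w + h + 1) * (1/2) ^ N).
          * apply Rmult_le_compat_r; [apply pow_le; lra|lra].
          * replace del with ((w + h + 1) * (del / (w + h + 1))) by (field; lra).
            apply Rmult_lt_compat_l; lra.
        + unfold Rdiv; rewrite Rmult_1_l, pow_inv; field; apply pow_nonzero; lra. }
    destruct Hk as [k Hk].
    destruct (Hn k) as [x [y [[H1 [H2 [H3 [H4 H5]]]] [Hx Hy]]]].
    pose proof (Hq w k Hw); pose proof (Hq h k Hh).
    apply (Rlt_not_le _ _ H5).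
    assert (HR : ccont_rect Q x (x + w / 2 ^ k) y (y + h / 2 ^ k))
      by (intros u v Hu Hv; apply HQ; lra).
    rewrite <- (RI_minus_affine Q (- Q (x0, y0) + l * (x0, y0))%C (- l)%C)
      by (auto; lra).
    eapply Rle_trans; [apply RI_bound with (B := K / 4 * W k)|]; try lra.
    + intros u v Hu Hv; apply ccont_plus; [apply HR; auto|].
      apply ccont_plus; [apply ccont_const|].
      apply ccont_mult; [apply ccont_const|apply ccont_id].
    + intros u v Hu Hv.
      replace (Q (u, v) + (- Q (x0, y0) + l * (x0, y0) + - l * (u, v)))%C
        with (Q (u, v) - Q (x0, y0) - l * ((u, v) - (x0, y0)))%C by ring.
      assert (Cl : Cmod ((u, v) - (x0, y0)) <= W k).
      { eapply Rle_trans; [apply Cmod_le_abs|]; simpl; unfold W.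
        apply Rplus_le_compat; apply Rabs_le; lra. }
      eapply Rle_trans; [apply Hd; lra|].
      apply Rmult_le_compat_l; lra.
    + unfold W; right; ring_simplify; field.
      apply pow_nonzero; lra.
Qed.

(** * Circle means and the Cauchy formula *)

Definition cexp (z : C) : C := (exp (fst z) * cos (snd z), exp (fst z) * sin (snd z)).

Lemma cexp_plus (z w : C) : cexp (z + w) = (cexp z * cexp w)%C.
Proof.
  destruct z as [x y], w as [u v]; unfold cexp, Cplus, Cmult; simpl.
  rewrite exp_plus, cos_plus, sin_plus; f_equal; ring.
Qed.

Lemma derivable_pt_lim_0 (f : R -> R) (l : R) :
  derivable_pt_lim f 0 l -> forall eps, 0 < eps -> exists delta, 0 < delta /\
    forall h, Rabs h < delta -> Rabs (f h - f 0 - l * h) <= eps * Rabs h.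
Proof.
  intros H e He; destruct (H e He) as [d Hd].
  exists d; split; [apply cond_pos|]; intros h Hh.
  destruct (Req_dec h 0) as [->|N].
  - replace (f 0 - f 0 - l * 0) with 0 by ring; rewrite Rabs_R0; lra.
  - specialize (Hd h N Hh); rewrite Rplus_0_l in Hd.
    replace (f h - f 0 - l * h) with (((f h - f 0) / h - l) * h) by (field; auto).
    rewrite Rabs_mult; apply Rmult_le_compat_r; [apply Rabs_pos|lra].
Qed.

Lemma cderiv_cexp_0 : cderiv cexp 0 1.
Proof.
  apply cderiv_eps; intros e He.
  (* The error terms below add up to at most 6 times [e' * Cmod (x, y)], so [e / 8] suffices;
     [e' <= 1] is what bounds [exp x] by 2. *)
  set (e' := Rmin 1 (e / 8)).
  assert (He' : 0 < e') by (apply Rmin_glb_lt; lra).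
  assert (E1 : e' <= 1) by apply Rmin_l.
  assert (E8 : e' <= e / 8) by apply Rmin_r.
  destruct (derivable_pt_lim_0 exp _ (derivable_pt_lim_exp 0) e' He') as [d1 [D1 H1]].
  destruct (derivable_pt_lim_0 cos _ (derivable_pt_lim_cos 0) e' He') as [d2 [D2 H2]].
  destruct (derivable_pt_lim_0 sin _ (derivable_pt_lim_sin 0) e' He') as [d3 [D3 H3]].
  exists (Rmin (e' / 2) (Rmin d1 (Rmin d2 d3))); split.
  { repeat apply Rmin_glb_lt; lra. }
  intros [x y] Hw.
  assert (E0 : ((x, y) - 0)%C = (x, y))
    by (unfold Cminus, Cplus, Copp, RtoC; simpl; f_equal; ring).
  rewrite E0 in *.
  assert (Hx := re_le_Cmod (x, y)); assert (Hy := im_le_Cmod (x, y)); simpl in Hx, Hy.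
  unfold Re in Hx; simpl in Hx.
  pose proof (Rmin_l (e'/2) (Rmin d1 (Rmin d2 d3))).
  pose proof (Rmin_r (e'/2) (Rmin d1 (Rmin d2 d3))).
  pose proof (Rmin_l d1 (Rmin d2 d3)); pose proof (Rmin_r d1 (Rmin d2 d3)).
  pose proof (Rmin_l d2 d3); pose proof (Rmin_r d2 d3).
  assert (K1 := H1 x ltac:(lra)); assert (K2 := H2 y ltac:(lra));
    assert (K3 := H3 y ltac:(lra)).
  rewrite exp_0 in K1; rewrite cos_0, sin_0 in K2; rewrite sin_0, cos_0 in K3.
  replace (cos y - 1 - - 0 * y) with (cos y - 1) in K2 by ring.
  replace (sin y - 0 - 1 * y) with (sin y - y) in K3 by ring.
  replace (exp x - 1 - 1 * x) with (exp x - 1 - x) in K1 by ring.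
  pose proof (Rabs_pos x); pose proof (Rabs_pos y).
  assert (Kx : Rabs (exp x - 1) <= e').
  { replace (exp x - 1) with ((exp x - 1 - x) + x) by ring.
    eapply Rle_trans; [apply Rabs_triang|].
    assert (e' * Rabs x <= 1 * Rabs x) by (apply Rmult_le_compat_r; lra).
    lra. }
  assert (Kx2 : Rabs (exp x) <= 2).
  { replace (exp x) with ((exp x - 1) + 1) by ring.
    eapply Rle_trans; [apply Rabs_triang|]; rewrite Rabs_R1; lra. }
  replace (cexp (x, y) - cexp 0 - 1 * (x, y))%C
    with ((exp x - 1 - x + exp x * (cos y - 1),
           exp x * (sin y - y) + (exp x - 1) * y) : C).
  2:{ unfold cexp, Cminus, Cplus, Cmult, Copp, RtoC; simpl.
      rewrite exp_0, cos_0, sin_0; f_equal; ring. }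
  eapply Rle_trans; [apply Cmod_le_abs|]; simpl.
  eapply Rle_trans; [apply Rplus_le_compat; apply Rabs_triang|].
  rewrite !Rabs_mult.
  assert (Rabs (exp x) * Rabs (cos y - 1) <= 2 * (e' * Rabs y))
    by (apply Rmult_le_compat; auto using Rabs_pos).
  assert (Rabs (exp x) * Rabs (sin y - y) <= 2 * (e' * Rabs y))
    by (apply Rmult_le_compat; auto using Rabs_pos).
  assert (Rabs (exp x - 1) * Rabs y <= e' * Rabs y)
    by (apply Rmult_le_compat_r; auto).
  assert (e' * Rabs x <= e' * Cmod (x, y)) by (apply Rmult_le_compat_l; lra).
  assert (e' * Rabs y <= e' * Cmod (x, y)) by (apply Rmult_le_compat_l; lra).
  assert (e' * Cmod (x, y) <= e / 8 * Cmod (x, y))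
    by (apply Rmult_le_compat_r; [apply Cmod_ge_0|lra]).
  assert (0 <= e * Cmod (x, y)) by (apply Rmult_le_pos; [lra|apply Cmod_ge_0]).
  lra.
Qed.

Lemma cderiv_cexp (z : C) : cderiv cexp z (cexp z).
Proof.
  apply (cderiv_ext_near (fun w => cexp z * cexp (w - z))%C _ _ _ 1); [lra| |].
  - intros w _; rewrite <- cexp_plus; f_equal; ring.
  - assert (D : cderiv (fun w => cexp z * cexp (w - z))%C z
                  (0 * cexp (z - z) + cexp z * (1 * (1 - 0)))%C).
    { apply (cderiv_mult (fun _ => cexp z) (fun w => cexp (w - z)%C));
        [apply cderiv_const|].
      apply (cderiv_comp cexp (fun w => w - z)%C).
      + apply cderiv_minus; [apply cderiv_id|apply cderiv_const].
      + replace (z - z)%C with (RtoC 0) by ring; apply cderiv_cexp_0. }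
    replace (0 * cexp (z - z) + cexp z * (1 * (1 - 0)))%C with (cexp z) in D by ring.
    exact D.
Qed.

Definition circ (r t : R) : C := (r * cos t, r * sin t).

Lemma Cmod_circ (r t : R) : 0 <= r -> Cmod (circ r t) = r.
Proof.
  intros Hr; unfold Cmod, circ; simpl.
  replace (r * cos t * (r * cos t * 1) + r * sin t * (r * sin t * 1))
    with (r * r * (Rsqr (sin t) + Rsqr (cos t))) by (unfold Rsqr; ring).
  rewrite sin2_cos2, Rmult_1_r, sqrt_square; auto.
Qed.

Lemma rcont_circ (r t : R) : rcont (circ r) t.
Proof.
  apply rcont_pair; simpl;
    apply (ex_derive_continuous (V := R_NormedModule)); auto_derive; auto.
Qed.

Definition circ_cont (phi : C -> C) (r : R) : Prop :=
  forall w, Cmod w = r -> ccont phi w.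

(** This is 1/(2 pi i) times the contour integral of [phi(w) dw / w]. The measure [dw / w] is the
    reason why the Cauchy kernel appears below as [w / (w - z)]. *)
Definition cmean (r : R) (phi : C -> C) : C :=
  (/ RtoC (2 * PI) * CI (fun t => phi (circ r t)) 0 (2 * PI))%C.

Lemma two_PI_pos : 0 < 2 * PI.
Proof. pose proof PI_RGT_0; lra. Qed.

Lemma two_PI_neq_0 : RtoC (2 * PI) <> 0.
Proof. intros H; apply RtoC_inj in H; pose proof two_PI_pos; lra. Qed.

Lemma circ_cont_rcont (phi : C -> C) (r : R) :
  0 <= r -> circ_cont phi r -> rcont_on (fun t => phi (circ r t)) 0 (2 * PI).
Proof.
  intros Hr H t _; apply rcont_comp; [apply rcont_circ|].
  apply H, Cmod_circ; auto.
Qed.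

Lemma cmean_ext (r : R) (phi psi : C -> C) :
  0 <= r -> (forall w, Cmod w = r -> phi w = psi w) -> cmean r phi = cmean r psi.
Proof.
  intros Hr H; unfold cmean; f_equal; apply CI_ext; [pose proof two_PI_pos; lra|].
  intros t _; apply H, Cmod_circ; auto.
Qed.

Lemma cmean_plus (r : R) (phi psi : C -> C) :
  0 <= r -> circ_cont phi r -> circ_cont psi r ->
  cmean r (fun w => phi w + psi w)%C = (cmean r phi + cmean r psi)%C.
Proof.
  intros Hr H1 H2; unfold cmean; pose proof two_PI_pos.
  rewrite CI_plus by (try lra; apply circ_cont_rcont; auto); ring.
Qed.

Lemma cmean_scal (r : R) (k : C) (phi : C -> C) :
  0 <= r -> circ_cont phi r -> cmean r (fun w => k * phi w)%C = (k * cmean r phi)%C.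
Proof.
  intros Hr H1; unfold cmean; pose proof two_PI_pos.
  rewrite CI_scal by (try lra; apply circ_cont_rcont; auto); ring.
Qed.

Lemma cmean_minus (r : R) (phi psi : C -> C) :
  0 <= r -> circ_cont phi r -> circ_cont psi r ->
  cmean r (fun w => phi w - psi w)%C = (cmean r phi - cmean r psi)%C.
Proof.
  intros Hr H1 H2; unfold cmean; pose proof two_PI_pos.
  rewrite CI_minus by (try lra; apply circ_cont_rcont; auto); ring.
Qed.

Lemma cmean_const (r : R) (k : C) : cmean r (fun _ => k) = k.
Proof.
  unfold cmean; rewrite CI_const, Rminus_0_r; field; apply two_PI_neq_0.
Qed.

Lemma cmean_bound (r : R) (phi : C -> C) (B : R) :
  0 <= r -> circ_cont phi r -> (forall w, Cmod w = r -> Cmod (phi w) <= B) ->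
  Cmod (cmean r phi) <= 2 * B.
Proof.
  intros Hr H1 H2; unfold cmean; pose proof two_PI_pos.
  rewrite Cmod_mult, Cmod_inv by apply two_PI_neq_0.
  rewrite Cmod_R, Rabs_pos_eq by lra.
  apply Rmult_le_reg_l with (2 * PI); auto.
  rewrite <- Rmult_assoc, Rinv_r, Rmult_1_l by lra.
  eapply Rle_trans; [apply (CI_bound _ _ _ B)|]; try lra.
  - apply circ_cont_rcont; auto.
  - intros t _; apply H2, Cmod_circ; auto.
Qed.

(** Goursat's theorem for [phi o exp] on a rectangle of height [2 pi], whose
    horizontal sides cancel by periodicity. *)
Lemma cmean_annulus (phi : C -> C) (r1 r2 : R) :
  0 < r1 -> r1 <= r2 -> (forall w, r1 <= Cmod w <= r2 -> cdiff phi w) ->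
  cmean r1 phi = cmean r2 phi.
Proof.
  intros H1 H2 HD; unfold cmean; f_equal.
  pose proof two_PI_pos.
  assert (Hln : ln r1 <= ln r2) by (apply ln_le; auto).
  assert (G : RI (fun z => phi (cexp z)) (ln r1) (ln r2) 0 (2 * PI) = 0).
  { apply Goursat_rectangle; [auto|lra|].
    intros x y Hx _.
    assert (Hm : r1 <= Cmod (cexp (x, y)) <= r2).
    { change (cexp (x, y)) with (circ (exp x) y).
      rewrite Cmod_circ by (apply Rlt_le, exp_pos).
      split.
      - rewrite <- (exp_ln r1) by auto.
        destruct (proj1 Hx) as [L|<-]; [apply Rlt_le, exp_increasing; auto|lra].
      - rewrite <- (exp_ln r2) by lra.
        destruct (proj2 Hx) as [L|<-]; [apply Rlt_le, exp_increasing; auto|lra]. }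
    destruct (HD _ Hm) as [l Hl].
    exists (l * cexp (x, y))%C.
    apply cderiv_comp; [apply cderiv_cexp|auto]. }
  unfold RI in G.
  assert (P : CI (fun x => phi (cexp (x, 0))) (ln r1) (ln r2)
            = CI (fun x => phi (cexp (x, 2 * PI))) (ln r1) (ln r2)).
  { apply CI_ext; auto; intros t _; unfold cexp; simpl.
    rewrite cos_2PI, sin_2PI, cos_0, sin_0; auto. }
  rewrite P in G.
  assert (E : forall r, 0 < r -> CI (fun y => phi (cexp (ln r, y))) 0 (2 * PI)
              = CI (fun t => phi (circ r t)) 0 (2 * PI)).
  { intros r Hr; apply CI_ext; [lra|]; intros t _; unfold cexp, circ; simpl.
    rewrite exp_ln; auto. }
  rewrite !E in G by lra.
  assert (G2 : (CI (fun t => phi (circ r2 t)) 0 (2 * PI)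
              - CI (fun t => phi (circ r1 t)) 0 (2 * PI))%C = 0).
  { match goal with |- ?X = _ =>
      replace X with (- Ci * (Ci * X))%C end.
    - match type of G with ?Y = _ =>
        replace (- Ci * Y)%C with (RtoC 0) by (rewrite G; ring) end.
      match type of G with (?A + ?B)%C = _ =>
        replace B with (RtoC 0) by (rewrite <- G; ring) end.
      ring.
    - replace (- Ci * (Ci * (CI (fun t => phi (circ r2 t)) 0 (2 * PI)
              - CI (fun t => phi (circ r1 t)) 0 (2 * PI))))%C
        with ((- (Ci * Ci)) * (CI (fun t => phi (circ r2 t)) 0 (2 * PI)
              - CI (fun t => phi (circ r1 t)) 0 (2 * PI)))%C by ring.
      replace (- (Ci * Ci))%C with (RtoC 1)
        by (unfold Ci, Cmult, Copp, RtoC; simpl; f_equal; ring).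
      ring. }
  symmetry; apply Ceq_minus; exact G2.
Qed.

Lemma Cmod_eq_eps (z w : C) : (forall eps, 0 < eps -> Cmod (z - w) <= eps) -> z = w.
Proof.
  intros H; apply Ceq_minus, Cmod_eq_0, Rle_antisym; [|apply Cmod_ge_0].
  apply le_epsilon; intros e He; rewrite Rplus_0_l; auto.
Qed.

(** The mean is the same on all circles, and on a small one of radius [s] continuity at 0 alone
    brings it close to [phi 0]. *)
Lemma cmean_center (phi : C -> C) (R r : R) :
  0 < r < R -> ccont phi 0 -> (forall w, 0 < Cmod w < R -> cdiff phi w) ->
  cmean r phi = phi 0.
Proof.
  intros Hr H0 HD; apply Cmod_eq_eps; intros e He.
  destruct (H0 (e / 2)) as [d [Hd Hw]]; [lra|].
  set (s := Rmin r (d / 2)).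
  assert (Hs : 0 < s) by (apply Rmin_glb_lt; lra).
  assert (s <= r) by apply Rmin_l.
  assert (s <= d / 2) by apply Rmin_r.
  rewrite <- (cmean_annulus phi s r) by (auto; intros; apply HD; lra).
  assert (Cs : circ_cont phi s).
  { intros w Ew; destruct (HD w) as [l Hl]; [lra|]; eapply cderiv_ccont; eauto. }
  rewrite <- (cmean_const s (phi 0)) at 1.
  rewrite <- cmean_minus by (auto; try lra; intros w _; apply ccont_const).
  replace e with (2 * (e / 2)) by field.
  apply cmean_bound; [lra| |].
  - intros w Ew; apply ccont_plus; auto; apply ccont_const.
  - intros w Ew; apply Rlt_le, Hw.
    replace (w - 0)%C with w by ring; lra.
Qed.

Lemma cos_sin_lipschitz (x y : R) :
  Rabs (cos x - cos y) <= Rabs (x - y) /\ Rabs (sin x - sin y) <= Rabs (x - y).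
Proof.
  split; rewrite <- (Rmult_1_l (Rabs (x - y))).
  - apply (bounded_variation cos (fun t => - sin t)); intros t _; split.
    + auto_derive; auto; ring.
    + rewrite Rabs_Ropp; apply Rabs_le, SIN_bound.
  - apply (bounded_variation sin cos); intros t _; split.
    + auto_derive; auto; ring.
    + apply Rabs_le, COS_bound.
Qed.

Lemma circ_lipschitz (u v x y : R) :
  Cmod (circ u v - circ x y) <= 2 * Rabs (u - x) + 2 * Rabs x * Rabs (v - y).
Proof.
  eapply Rle_trans; [apply Cmod_le_abs|]; simpl.
  destruct (cos_sin_lipschitz v y) as [Lc Ls].
  replace (u * cos v + - (x * cos y)) with ((u - x) * cos v + x * (cos v - cos y)) by ring.
  replace (u * sin v + - (x * sin y)) with ((u - x) * sin v + x * (sin v - sin y)) by ring.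
  eapply Rle_trans; [apply Rplus_le_compat; apply Rabs_triang|].
  rewrite !Rabs_mult.
  assert (Rabs (cos v) <= 1) by apply Rabs_le, COS_bound.
  assert (Rabs (sin v) <= 1) by apply Rabs_le, SIN_bound.
  pose proof (Rabs_pos (u - x)); pose proof (Rabs_pos x).
  assert (Rabs (u - x) * Rabs (cos v) <= Rabs (u - x) * 1) by (apply Rmult_le_compat_l; lra).
  assert (Rabs (u - x) * Rabs (sin v) <= Rabs (u - x) * 1) by (apply Rmult_le_compat_l; lra).
  assert (Rabs x * Rabs (cos v - cos y) <= Rabs x * Rabs (v - y))
    by (apply Rmult_le_compat_l; lra).
  assert (Rabs x * Rabs (sin v - sin y) <= Rabs x * Rabs (v - y))
    by (apply Rmult_le_compat_l; lra).
  lra.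
Qed.

Lemma ccont_circ_2d (phi : C -> C) (x y : R) :
  ccont phi (circ x y) -> forall eps, 0 < eps -> exists delta : posreal,
    forall u v, Rabs (u - x) < delta -> Rabs (v - y) < delta ->
      Cmod (phi (circ u v) - phi (circ x y)) < eps.
Proof.
  intros H e He; destruct (H e He) as [d [Hd Hw]].
  assert (Hx := Rabs_pos x).
  assert (Hd' : 0 < d / (2 + 2 * Rabs x)) by (apply Rdiv_lt_0_compat; lra).
  exists (mkposreal _ Hd'); simpl; intros u v Hu Hv; apply Hw.
  eapply Rle_lt_trans; [apply circ_lipschitz|].
  replace d with (2 * (d / (2 + 2 * Rabs x)) + 2 * Rabs x * (d / (2 + 2 * Rabs x)))
    by (field; lra).
  apply Rplus_lt_le_compat; [lra|].
  apply Rmult_le_compat_l; lra.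
Qed.

Lemma cmean_continuous (phi : C -> C) (R s : R) :
  0 < s < R -> (forall w, 0 < Cmod w < R -> ccont phi w) ->
  forall eps, 0 < eps -> exists delta, 0 < delta /\
    forall t, Rabs (t - s) < delta -> Cmod (cmean t phi - cmean s phi) <= eps.
Proof.
  intros Hs HC e He.
  set (s1 := s / 2); set (s2 := (s + R) / 2).
  assert (Cc : forall x y, s1 <= x <= s2 -> 0 <= y <= 2 * PI -> ccont phi (circ x y)).
  { intros x y Hx _; apply HC; rewrite Cmod_circ; unfold s1, s2 in *; lra. }
  (* Real and imaginary parts contribute [e / 4] each, and [CI_bound] doubles their sum. *)
  assert (He4 : 0 < e / 4) by lra.
  destruct (uniform_continuity_2d (fun t y => fst (phi (circ t y))) s1 s2 0 (2 * PI))
    with (eps := mkposreal _ He4) as [d1 H1].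
  { intros x y Hx Hy ep.
    destruct (ccont_circ_2d phi x y (Cc x y Hx Hy) ep (cond_pos ep)) as [d Hd].
    exists d; intros u v Hu Hv; eapply Rle_lt_trans; [|apply (Hd u v Hu Hv)].
    exact (re_le_Cmod (phi (circ u v) - phi (circ x y))). }
  destruct (uniform_continuity_2d (fun t y => snd (phi (circ t y))) s1 s2 0 (2 * PI))
    with (eps := mkposreal _ He4) as [d2 H2].
  { intros x y Hx Hy ep.
    destruct (ccont_circ_2d phi x y (Cc x y Hx Hy) ep (cond_pos ep)) as [d Hd].
    exists d; intros u v Hu Hv; eapply Rle_lt_trans; [|apply (Hd u v Hu Hv)].
    exact (im_le_Cmod (phi (circ u v) - phi (circ x y))). }
  simpl in H1, H2.
  exists (Rmin (Rmin (s / 2) ((R - s) / 2)) (Rmin d1 d2)); split.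
  { repeat apply Rmin_glb_lt; try lra; apply cond_pos. }
  intros t Ht.
  pose proof (Rmin_l (Rmin (s / 2) ((R - s) / 2)) (Rmin d1 d2)).
  pose proof (Rmin_r (Rmin (s / 2) ((R - s) / 2)) (Rmin d1 d2)).
  pose proof (Rmin_l (s / 2) ((R - s) / 2)); pose proof (Rmin_r (s / 2) ((R - s) / 2)).
  pose proof (Rmin_l d1 d2); pose proof (Rmin_r d1 d2).
  assert (T := Rabs_def2 _ _ Ht).
  assert (Tt : s1 <= t <= s2) by (unfold s1, s2; lra).
  assert (Ts : s1 <= s <= s2) by (unfold s1, s2; lra).
  pose proof two_PI_pos.
  assert (Ct : circ_cont phi t) by (intros w Hw; apply HC; unfold s1, s2 in *; lra).
  assert (Cs : circ_cont phi s) by (intros w Hw; apply HC; unfold s1, s2 in *; lra).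
  unfold cmean.
  replace (/ RtoC (2 * PI) * CI (fun y => phi (circ t y)) 0 (2 * PI)
           - / RtoC (2 * PI) * CI (fun y => phi (circ s y)) 0 (2 * PI))%C
    with (/ RtoC (2 * PI) * (CI (fun y => phi (circ t y)) 0 (2 * PI)
           - CI (fun y => phi (circ s y)) 0 (2 * PI)))%C
    by ring.
  rewrite <- CI_minus;
    [|lra|apply circ_cont_rcont; auto; lra|apply circ_cont_rcont; auto; lra].
  rewrite Cmod_mult, Cmod_inv by apply two_PI_neq_0.
  rewrite Cmod_R, Rabs_pos_eq by lra.
  apply Rmult_le_reg_l with (2 * PI); auto.
  rewrite <- Rmult_assoc, Rinv_r, Rmult_1_l by lra.
  eapply Rle_trans; [apply (CI_bound _ _ _ (e / 2))|]; try lra.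
  - intros y Hy; apply (rcont_pair _ y); apply (continuous_minus (V := R_NormedModule));
      first [apply (rcont_re (fun y => phi (circ _ y)))|apply (rcont_im (fun y => phi (circ _ y)))];
      apply (circ_cont_rcont phi); auto; lra.
  - intros y Hy; eapply Rle_trans; [apply Cmod_le_abs|].
    assert (L1 := H1 s y t y Ts Hy Tt Hy ltac:(lra)
      ltac:(rewrite Rminus_diag, Rabs_R0; apply cond_pos)).
    assert (L2 := H2 s y t y Ts Hy Tt Hy ltac:(lra)
      ltac:(rewrite Rminus_diag, Rabs_R0; apply cond_pos)).
    change (Rabs (fst (phi (circ t y)) - fst (phi (circ s y)))
          + Rabs (snd (phi (circ t y)) - snd (phi (circ s y))) <= e / 2).
    lra.
Qed.

(** An exceptional circle of mere continuity does not affect the mean value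
    property, since the means depend continuously on the radius. *)
Lemma cmean_center_exceptional (phi : C -> C) (R s r : R) :
  0 < s < r -> r < R -> (forall w, Cmod w < R -> ccont phi w) ->
  (forall w, Cmod w < R -> Cmod w <> s -> cdiff phi w) ->
  cmean r phi = phi 0.
Proof.
  intros Hs Hr HC HD; apply Cmod_eq_eps; intros e He.
  destruct (cmean_continuous phi R s) with (eps := e / 2) as [d [Hd Hw]];
    [lra|intros; apply HC; lra|lra|].
  set (d' := Rmin (d / 2) (Rmin (s / 2) (r - s))).
  assert (Hd' : 0 < d') by (repeat apply Rmin_glb_lt; lra).
  assert (d' <= d / 2) by apply Rmin_l.
  assert (d' <= s / 2) by (eapply Rle_trans; [apply Rmin_r|apply Rmin_l]).
  assert (d' <= r - s) by (eapply Rle_trans; [apply Rmin_r|apply Rmin_r]).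
  rewrite <- (cmean_annulus phi (s + d') r)
    by (try lra; intros w Hw'; apply HD; lra).
  rewrite <- (cmean_center phi s (s - d'));
    [|lra|apply HC; rewrite Cmod_0; lra|intros w Hw'; apply HD; lra].
  assert (L1 : Cmod (cmean (s + d') phi - cmean s phi) <= e / 2).
  { apply Hw; replace (s + d' - s) with d' by ring; rewrite Rabs_pos_eq; lra. }
  assert (L2 : Cmod (cmean (s - d') phi - cmean s phi) <= e / 2).
  { apply Hw; replace (s - d' - s) with (- d') by ring.
    rewrite Rabs_Ropp, Rabs_pos_eq; lra. }
  replace (cmean (s + d') phi - cmean (s - d') phi)%C
    with ((cmean (s + d') phi - cmean s phi) - (cmean (s - d') phi - cmean s phi))%C
    by ring.
  eapply Rle_trans; [apply Cmod_triangle_minus|lra].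
Qed.

Lemma cdiff_ccont (f : C -> C) (z : C) : cdiff f z -> ccont f z.
Proof. intros [l H]; eapply cderiv_ccont; eauto. Qed.

Lemma Cmod_lt_neq (z w : C) : Cmod z < Cmod w -> (w - z)%C <> 0.
Proof. intros H E; apply Ceq_minus in E; subst; lra. Qed.

Lemma Cmod_pos_neq (z : C) : 0 < Cmod z -> z <> 0.
Proof. intros H; apply Cmod_gt_0; auto. Qed.

Lemma cdiff_minus_const (f : C -> C) (k z : C) :
  cdiff f z -> cdiff (fun w => f w - k)%C z.
Proof.
  intros [l H]; exists (l - 0)%C; apply cderiv_minus; auto; apply cderiv_const.
Qed.

Lemma cdiff_mult (f g : C -> C) (z : C) :
  cdiff f z -> cdiff g z -> cdiff (fun w => f w * g w)%C z.
Proof.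
  intros [l H] [m K]; eexists; apply cderiv_mult; eauto.
Qed.

Lemma cdiff_inv (f : C -> C) (z : C) :
  cdiff f z -> f z <> 0 -> cdiff (fun w => / f w)%C z.
Proof. intros [l H] N; exact (cderiv_inv f z l H N). Qed.

Lemma cdiff_id (z : C) : cdiff (fun w => w) z.
Proof. exists 1; apply cderiv_id. Qed.

Lemma cdiff_kernel (z w : C) : w <> z -> cdiff (fun v => v / (v - z))%C w.
Proof.
  intros N; apply cdiff_mult; [apply cdiff_id|].
  apply (cdiff_inv (fun v => v - z)%C); [|apply Cminus_eq_contra; auto].
  apply cdiff_minus_const, cdiff_id.
Qed.

(** The mean does not change as the circle grows, and the kernel tends to 1 at infinity. The radius
    [r'] makes [Cmod (w - z)] at least [2 * Cmod z / e], so that the kernel is within [e / 2] of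
    1. *)
Lemma cmean_kernel (r : R) (z : C) :
  Cmod z < r -> cmean r (fun w => w / (w - z))%C = 1.
Proof.
  intros Hz; pose proof (Cmod_ge_0 z).
  apply Cmod_eq_eps; intros e He.
  set (r' := r + 2 * Cmod z / e).
  assert (0 <= 2 * Cmod z / e) by (apply Rdiv_le_0_compat; lra).
  rewrite (cmean_annulus _ r r') by
    (unfold r'; try lra; intros w Hw; apply cdiff_kernel; intros ->; lra).
  assert (Hc : circ_cont (fun w => w / (w - z))%C r').
  { intros w Hw; apply cdiff_ccont, cdiff_kernel; intros ->; unfold r' in *; lra. }
  rewrite <- (cmean_const r' 1).
  rewrite <- cmean_minus by (try (unfold r'; lra); auto; intros w _; apply ccont_const).
  replace e with (2 * (e / 2)) by field.
  apply cmean_bound; [unfold r'; lra| |].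
  - intros w Hw; apply ccont_plus; [auto|apply ccont_const].
  - intros w Hw.
    assert (N : (w - z)%C <> 0) by (apply Cmod_lt_neq; unfold r' in *; lra).
    replace (w / (w - z) - 1)%C with (z / (w - z))%C by (field; auto).
    rewrite Cmod_div by auto.
    pose proof (Cmod_triangle_rev w z) as T; rewrite Hw in T; unfold r' in T.
    apply Rmult_le_reg_r with (Cmod (w - z)); [lra|].
    unfold Rdiv; rewrite Rmult_assoc, Rinv_l, Rmult_1_r by lra.
    assert (Hm : 2 * Cmod z / e <= Cmod (w - z)) by lra.
    apply (Rmult_le_compat_l (e / 2)) in Hm; [|lra].
    replace (e / 2 * (2 * Cmod z / e)) with (Cmod z) in Hm by (field; lra).
    exact Hm.
Qed.

(** Factoring [f w = f z + q w * (w - z)] splits the integrand into [q w * w], whose mean is its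
    value 0 at the origin, and [f z] times the kernel, whose mean is [f z]. At [z] the factor [q] is
    known to be continuous only, hence the mean value property with the exceptional circle through
    [z]. *)
Lemma Cauchy_formula (f : C -> C) (R r : R) (z : C) :
  (forall w, Cmod w < R -> cdiff f w) -> Cmod z < r < R ->
  cmean r (fun w => f w * (w / (w - z)))%C = f z.
Proof.
  intros HD Hz.
  pose proof (Cmod_ge_0 z).
  assert (Ck : circ_cont (fun w => w / (w - z))%C r)
    by (intros w Hw; apply cdiff_ccont, cdiff_kernel; intros ->; lra).
  assert (Cf : circ_cont f r)
    by (intros w Hw; apply cdiff_ccont, HD; lra).
  (* An exceptional circle must have positive radius, so [z = 0] is treated apart; the kernel is
     then 1 on the circle. *)
  destruct (Req_dec (Cmod z) 0) as [Ez|Nz].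
  - apply Cmod_eq_0 in Ez; subst z.
    rewrite (cmean_ext _ _ f).
    + apply (cmean_center f R); [rewrite Cmod_0 in Hz; lra| |].
      * apply cdiff_ccont, HD; rewrite Cmod_0; lra.
      * intros w Hw; apply HD; lra.
    + lra.
    + intros w Hw; field.
      rewrite Cmod_0 in Hz; apply Cmod_pos_neq; lra.
  - destruct (HD z) as [l Hl]; [lra|].
    apply cderiv_caratheodory in Hl; destruct Hl as [q [Cq [Qz Qf]]].
    assert (Dq : forall w, Cmod w < R -> w <> z -> cdiff q w).
    { intros w Hw Nw.
      assert (Np : 0 < Cmod (w - z)) by (apply Cmod_gt_0, Cminus_eq_contra; auto).
      destruct (cdiff_mult (fun v => f v - f z)%C (fun v => / (v - z))%C w) as [m Hm].
      - apply cdiff_minus_const, HD; auto.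
      - apply (cdiff_inv (fun v => v - z)%C); [|apply Cminus_eq_contra; auto].
        apply cdiff_minus_const, cdiff_id.
      - exists m; eapply cderiv_ext_near; [exact Np| |exact Hm].
        intros v Hv; simpl; rewrite (Qf v); field.
        intros E; apply Ceq_minus in E; subst v.
        rewrite Cmod_minus_sym in Hv; lra. }
    assert (M : cmean r (fun w => q w * w)%C = (q 0 * 0)%C).
    { apply (cmean_center_exceptional (fun w => q w * w)%C R (Cmod z) r); [lra|lra| |].
      - intros w Hw; apply ccont_mult; [|apply ccont_id].
        destruct (excluded_middle_informative (w = z)) as [->|N]; auto.
        apply cdiff_ccont; auto.
      - intros w Hw N; apply cdiff_mult; [|apply cdiff_id].
        apply Dq; auto; intros ->; auto. }
    rewrite Cmult_0_r in M.
    rewrite (cmean_ext r _ (fun w => q w * w + f z * (w / (w - z)))%C).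
    + rewrite cmean_plus, M, cmean_scal, cmean_kernel; try lra; auto.
      * ring.
      * intros w Hw; apply ccont_mult; [|apply ccont_id].
        apply cdiff_ccont, Dq; [lra|intros ->; lra].
      * intros w Hw; apply ccont_mult; [apply ccont_const|auto].
    + lra.
    + intros w Hw; rewrite (Qf w) at 1; field.
      apply Cmod_lt_neq; lra.
Qed.

(** * Leading terms of holomorphic functions *)

Lemma cdiff_const (k z : C) : cdiff (fun _ => k) z.
Proof. exists 0; apply cderiv_const. Qed.

Lemma cdiff_pow (f : C -> C) (n : nat) (z : C) :
  cdiff f z -> cdiff (fun w => f w ^ n)%C z.
Proof.
  intros H; induction n as [|n IH]; [exact (cdiff_const 1 z)|].
  exact (cdiff_mult f (fun w => f w ^ n)%C z H IH).
Qed.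

(** Cauchy's integral for the coefficient of [z ^ m], in the [dw / w] normalisation. *)
Definition taylor_coef (r : R) (f : C -> C) (m : nat) : C :=
  cmean r (fun w => f w * (/ w) ^ m)%C.

(** What is left of the Cauchy formula once the first [m] terms of the geometric series of
    [w / (w - z)] in powers of [z / w] are removed. *)
Definition taylor_tail (r : R) (f : C -> C) (m : nat) (z : C) : C :=
  cmean r (fun w => f w * ((z / w) ^ m * (w / (w - z))))%C.

Lemma circ_cont_tail (r : R) (f : C -> C) (m : nat) (z : C) :
  circ_cont f r -> Cmod z < r ->
  circ_cont (fun w => f w * ((z / w) ^ m * (w / (w - z))))%C r.
Proof.
  intros Cf Hz w Hw; pose proof (Cmod_ge_0 z).
  apply ccont_mult; [auto|]; apply cdiff_ccont, cdiff_mult.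
  - apply (cdiff_pow (fun v => z / v)%C); apply cdiff_mult; [apply cdiff_const|].
    apply (cdiff_inv (fun v => v)); [apply cdiff_id|apply Cmod_pos_neq; lra].
  - apply cdiff_kernel; intros ->; lra.
Qed.

Lemma taylor_tail_0 (R r : R) (f : C -> C) (z : C) :
  (forall w, Cmod w < R -> cdiff f w) -> Cmod z < r < R -> taylor_tail r f 0 z = f z.
Proof.
  intros HD Hz; rewrite <- (Cauchy_formula f R r z) by auto.
  pose proof (Cmod_ge_0 z).
  apply cmean_ext; [lra|]; intros w _; simpl; ring.
Qed.

(** One step of the geometric series: [w / (w - z) = 1 + (z / w) * (w / (w - z))], and the term 1
    yields the coefficient. *)
Lemma taylor_tail_S (r : R) (f : C -> C) (m : nat) (z : C) :
  circ_cont f r -> Cmod z < r ->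
  taylor_tail r f m z = (taylor_coef r f m * z ^ m + taylor_tail r f (S m) z)%C.
Proof.
  intros Cf Hz; pose proof (Cmod_ge_0 z); unfold taylor_tail, taylor_coef.
  assert (Cc : circ_cont (fun w => f w * (/ w) ^ m)%C r).
  { intros w Hw; apply ccont_mult; [auto|].
    apply cdiff_ccont, (cdiff_pow (fun v => / v)%C).
    apply (cdiff_inv (fun v => v)); [apply cdiff_id|apply Cmod_pos_neq; lra]. }
  rewrite (Cmult_comm (cmean _ _)), <- cmean_scal by (auto; lra).
  rewrite <- cmean_plus; [|lra| |apply circ_cont_tail; auto].
  2:{ intros w Hw; apply ccont_mult; [apply ccont_const|auto]. }
  apply cmean_ext; [lra|]; intros w Hw.
  assert (N1 : w <> 0) by (apply Cmod_pos_neq; lra).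
  assert (N2 : (w - z)%C <> 0) by (apply Cmod_lt_neq; lra).
  rewrite Cpow_S; unfold Cdiv at 1 4; rewrite !Cpow_mult_l.
  field; auto.
Qed.

Lemma Cpow_minus_bound (z w : C) (rho : R) (m : nat) :
  Cmod z <= rho -> Cmod w <= rho ->
  Cmod (w ^ S m - z ^ S m) <= INR (S m) * rho ^ m * Cmod (w - z).
Proof.
  intros Hz Hw; pose proof (Cmod_ge_0 z).
  induction m as [|m IH].
  - simpl; replace (w * 1 - z * 1)%C with (w - z)%C by ring; lra.
  - replace (w ^ S (S m) - z ^ S (S m))%C
      with (w * (w ^ S m - z ^ S m) + (w - z) * z ^ S m)%C
      by (rewrite !(Cpow_S _ (S m)); ring).
    eapply Rle_trans; [apply Cmod_triangle|].
    rewrite !Cmod_mult, Cmod_pow, (S_INR (S m)).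
    pose proof (Cmod_ge_0 (w - z)).
    assert (L1 : Cmod w * Cmod (w ^ S m - z ^ S m)
              <= rho * (INR (S m) * rho ^ m * Cmod (w - z)))
      by (apply Rmult_le_compat; auto using Cmod_ge_0).
    assert (L2 : Cmod (w - z) * Cmod z ^ S m <= Cmod (w - z) * rho ^ S m)
      by (apply Rmult_le_compat_l; [auto|apply pow_incr; lra]).
    simpl pow in *; lra.
Qed.

(** Averaged against [f], this Lipschitz bound on the tail kernel becomes the increment estimate
    that [leading] demands. *)
Lemma tail_kernel_bound (v z w : C) (r : R) (m : nat) :
  0 < r -> Cmod v = r -> Cmod z <= r / 2 -> Cmod w <= r / 2 ->
  Cmod ((w / v) ^ S m * (v / (v - w)) - (z / v) ^ S m * (v / (v - z)))
  <= (INR (S m) + 1) * 2 / (r * r ^ m) * Rmax (Cmod z) (Cmod w) ^ m * Cmod (w - z).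
Proof.
  intros Hr Hv Hz Hw; set (rho := Rmax (Cmod z) (Cmod w)).
  assert (Rz : Cmod z <= rho) by apply Rmax_l.
  assert (Rw : Cmod w <= rho) by apply Rmax_r.
  pose proof (Cmod_ge_0 z); pose proof (Cmod_ge_0 w); pose proof (Cmod_ge_0 (w - z)).
  assert (Nv : v <> 0) by (apply Cmod_pos_neq; lra).
  assert (Nz : (v - z)%C <> 0) by (apply Cmod_lt_neq; lra).
  assert (Nw : (v - w)%C <> 0) by (apply Cmod_lt_neq; lra).
  assert (Dz : r / 2 <= Cmod (v - z)) by (pose proof (Cmod_triangle_rev v z); lra).
  assert (Dw : r / 2 <= Cmod (v - w)) by (pose proof (Cmod_triangle_rev v w); lra).
  (* The denominator is changed first, then the power. Each change carries a factor [w - z], and the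
     two account for the summands 1 and [INR (S m)] of the constant. *)
  replace ((w / v) ^ S m * (v / (v - w)) - (z / v) ^ S m * (v / (v - z)))%C
    with ((/ v) ^ m * (w ^ m * (w / (v - w)) * ((w - z) / (v - z))
          + (w ^ S m - z ^ S m) / (v - z)))%C.
  2:{ unfold Cdiv at 4 6; rewrite !Cpow_mult_l, !Cpow_S; field; auto. }
  rewrite Cmod_mult, Cmod_pow, Cmod_inv, Hv by auto.
  assert (Hrm : 0 < r ^ m) by (apply pow_lt; auto).
  rewrite pow_inv.
  assert (Hrho : 0 <= rho ^ m) by (apply pow_le; lra).
  assert (I : forall u, r / 2 <= Cmod u -> forall c, u <> 0 ->
            Cmod (c / u) <= 2 / r * Cmod c).
  { intros u Hu c Nu; rewrite Cmod_div by auto.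
    pose proof (Cmod_ge_0 c).
    apply Rmult_le_reg_r with (Cmod u); [lra|].
    unfold Rdiv at 1; rewrite Rmult_assoc, Rinv_l, Rmult_1_r by lra.
    assert (2 / r * (r / 2) <= 2 / r * Cmod u)
      by (apply Rmult_le_compat_l; [apply Rlt_le, Rdiv_lt_0_compat; lra|lra]).
    replace (2 / r * (r / 2)) with 1 in H3 by (field; lra).
    replace (2 / r * Cmod c * Cmod u) with (2 / r * Cmod u * Cmod c) by ring.
    nra. }
  assert (S1 : Cmod (w ^ m * (w / (v - w)) * ((w - z) / (v - z)))
             <= rho ^ m * (2 / r * Cmod (w - z))).
  { rewrite !Cmod_mult, Cmod_pow.
    apply Rmult_le_compat; try apply Cmod_ge_0.
    - apply Rmult_le_pos; [apply pow_le; auto|apply Cmod_ge_0].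
    - rewrite <- (Rmult_1_r (rho ^ m)).
      apply Rmult_le_compat; [apply pow_le; auto|apply Cmod_ge_0|apply pow_incr; lra|].
      eapply Rle_trans; [apply I; auto|].
      replace 1 with (2 / r * (r / 2)) by (field; lra).
      apply Rmult_le_compat_l; [apply Rlt_le, Rdiv_lt_0_compat; lra|auto].
    - apply I; auto. }
  assert (S2 : Cmod ((w ^ S m - z ^ S m) / (v - z))
             <= 2 / r * (INR (S m) * rho ^ m * Cmod (w - z))).
  { eapply Rle_trans; [apply I; auto|].
    apply Rmult_le_compat_l; [apply Rlt_le, Rdiv_lt_0_compat; lra|].
    apply Cpow_minus_bound; auto. }
  replace ((INR (S m) + 1) * 2 / (r * r ^ m) * rho ^ m * Cmod (w - z))
    with (/ r ^ m * (rho ^ m * (2 / r * Cmod (w - z))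
          + 2 / r * (INR (S m) * rho ^ m * Cmod (w - z)))) by (field; lra).
  apply Rmult_le_compat_l; [apply Rlt_le, Rinv_0_lt_compat; auto|].
  eapply Rle_trans; [apply Cmod_triangle|lra].
Qed.

(** [germ_eq f g] unfolds to [near (fun z => f z = g z)] and [holo_near0] to a [near] statement as
    well, so one calculus of neighbourhoods serves for germ identities and for holomorphy. *)
Definition near (P : C -> Prop) : Prop :=
  exists eps, 0 < eps /\ forall z, Cmod z < eps -> P z.

(** The remainder is controlled together with its increments, so that the
    expansion can be substituted into itself without differentiating it. *)
Definition leading (f : C -> C) (m : nat) (b : C) : Prop :=
  f 0 = (b * 0 ^ m)%C /\
  exists K eps, 0 <= K /\ 0 < eps /\
    forall z w, Cmod z < eps -> Cmod w < eps ->
      Cmod ((f w - b * w ^ m) - (f z - b * z ^ m))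
      <= K * Rmax (Cmod z) (Cmod w) ^ m * Cmod (w - z).

(** If some Taylor coefficient is nonzero, the first such gives the leading term, with the next tail
    as remainder. If all vanish, [f] equals its tail of every order, and on the half disc these
    tails decay geometrically. *)
Lemma holo_zero_or_leading (f : C -> C) :
  holo_near0 f ->
  near (fun z => f z = 0) \/ exists (m : nat) (b : C), b <> 0 /\ leading f m b.
Proof.
  intros [R [HR HD0]].
  assert (HD : forall w, Cmod w < R -> cdiff f w) by exact HD0.
  assert (C0 : ccont f 0) by (apply cdiff_ccont, HD; rewrite Cmod_0; auto).
  destruct (C0 1) as [d [Hd Hf]]; [lra|].
  set (r := Rmin (R / 2) (d / 2)).
  assert (Hr : 0 < r) by (apply Rmin_glb_lt; lra).
  assert (r <= R / 2) by apply Rmin_l.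
  assert (r <= d / 2) by apply Rmin_r.
  set (B := Cmod (f 0) + 1).
  assert (HB0 : 1 <= B) by (pose proof (Cmod_ge_0 (f 0)); unfold B; lra).
  assert (HB : forall w, Cmod w = r -> Cmod (f w) <= B).
  { intros w Hw; assert (L : Cmod (w - 0) < d) by (replace (w - 0)%C with w by ring; lra).
    specialize (Hf w L); pose proof (Cmod_triangle_rev (f w) (f 0)); unfold B; lra. }
  assert (Cf : circ_cont f r) by (intros w Hw; apply cdiff_ccont, HD; lra).
  assert (Low : forall m, (forall k, (k < m)%nat -> taylor_coef r f k = 0) ->
            forall z, Cmod z < r -> f z = taylor_tail r f m z).
  { induction m as [|m IH]; intros Hk z Hz.
    - symmetry; apply (taylor_tail_0 R); auto; lra.
    - rewrite IH by auto.
      rewrite taylor_tail_S, Hk by auto; ring. }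
  destruct (classic (exists m, taylor_coef r f m <> 0)) as [Hex|Hno].
  - right.
    destruct (dec_inh_nat_subset_has_unique_least_element
      (fun m => taylor_coef r f m <> 0)) as [m [[Hm Hmin] _]]; auto.
    { intros n; apply classic. }
    assert (Hk : forall k, (k < m)%nat -> taylor_coef r f k = 0).
    { intros k Hk; apply NNPP; intros N; specialize (Hmin k N); lia. }
    set (b := taylor_coef r f m) in *.
    assert (E : forall z, Cmod z < r -> (f z - b * z ^ m)%C = taylor_tail r f (S m) z).
    { intros z Hz; rewrite (Low m Hk z Hz), taylor_tail_S by auto; fold b; ring. }
    exists m, b; split; [auto|split].
    + apply Ceq_minus; rewrite E by (rewrite Cmod_0; auto).
      unfold taylor_tail; rewrite (cmean_ext _ _ (fun _ => RtoC 0)), cmean_const; auto; [lra|].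
      intros w Hw; rewrite Cpow_S; unfold Cdiv; ring.
    + exists (2 * (B * ((INR (S m) + 1) * 2 / (r * r ^ m)))), (r / 2).
      assert (HK : 0 <= (INR (S m) + 1) * 2 / (r * r ^ m)).
      { apply Rmult_le_pos; [pose proof (pos_INR (S m)); lra|].
        apply Rlt_le, Rinv_0_lt_compat, Rmult_lt_0_compat; [auto|apply pow_lt; auto]. }
      split; [apply Rmult_le_pos; [lra|apply Rmult_le_pos; lra]|].
      split; [lra|].
      intros z w Hz Hw.
      rewrite !E by lra; unfold taylor_tail.
      rewrite <- cmean_minus; [|lra|apply circ_cont_tail; auto; lra
                                  |apply circ_cont_tail; auto; lra].
      set (T := Rmax (Cmod z) (Cmod w) ^ m * Cmod (w - z)).
      replace (2 * (B * ((INR (S m) + 1) * 2 / (r * r ^ m)))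
               * Rmax (Cmod z) (Cmod w) ^ m * Cmod (w - z))
        with (2 * (B * ((INR (S m) + 1) * 2 / (r * r ^ m)
                   * Rmax (Cmod z) (Cmod w) ^ m * Cmod (w - z)))) by ring.
      apply cmean_bound; [lra| |].
      * intros v Hv.
        apply (ccont_plus (fun v => f v * ((w / v) ^ S m * (v / (v - w))))%C).
        -- apply (circ_cont_tail r f (S m) w); auto; lra.
        -- apply (ccont_ext_near (fun v => - (1) * (f v * ((z / v) ^ S m * (v / (v - z)))))%C
                    _ _ 1); [lra|intros; ring|].
           apply ccont_mult; [apply ccont_const|].
           apply (circ_cont_tail r f (S m) z); auto; lra.
      * intros v Hv.
        match goal with |- Cmod (?a * ?x - ?a * ?y) <= _ =>
          replace (a * x - a * y)%C with (a * (x - y))%C by ring end.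
        rewrite Cmod_mult; apply Rmult_le_compat; try apply Cmod_ge_0; [auto|].
        apply tail_kernel_bound; auto; lra.
  - left; exists (r / 2); split; [lra|]; intros z Hz.
    pose proof (Cmod_ge_0 z).
    assert (Hall : forall k, taylor_coef r f k = 0)
      by (intros k; apply NNPP; intros N; apply Hno; exists k; auto).
    apply Cmod_eq_eps; intros e He.
    (* Of the factor 4, one 2 comes from [cmean_bound] and the other bounds [v / (v - z)] when [z]
       lies in the half disc. *)
    destruct (pow_lt_1_zero (1/2)) with (y := e / (4 * B)) as [N HN].
    { rewrite Rabs_pos_eq; lra. }
    { apply Rdiv_lt_0_compat; lra. }
    specialize (HN N (le_n N)); rewrite Rabs_pos_eq in HN by (apply pow_le; lra).
    rewrite (Low N) by (auto; lra).
    replace (taylor_tail r f N z - 0)%C with (taylor_tail r f N z) by ring.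
    replace e with (2 * (B * (e / (4 * B) * 2))) by (field; lra).
    apply cmean_bound; [lra|apply circ_cont_tail; auto; lra|].
    intros v Hv.
    assert (Nv : v <> 0) by (apply Cmod_pos_neq; lra).
    assert (Nz : (v - z)%C <> 0) by (apply Cmod_lt_neq; lra).
    pose proof (Cmod_triangle_rev v z).
    rewrite !Cmod_mult, Cmod_pow, !Cmod_div, Hv by auto.
    apply Rmult_le_compat; try apply Cmod_ge_0; [|auto|].
    { apply Rmult_le_pos; [apply pow_le|]; apply Rdiv_le_0_compat; lra. }
    apply Rmult_le_compat.
    + apply pow_le, Rdiv_le_0_compat; lra.
    + apply Rdiv_le_0_compat; lra.
    + eapply Rle_trans; [|apply Rlt_le; exact HN].
      apply pow_incr; split; [apply Rdiv_le_0_compat; lra|].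
      apply Rmult_le_reg_r with r; auto.
      unfold Rdiv at 1; rewrite Rmult_assoc, Rinv_l, Rmult_1_r; lra.
    + apply Rmult_le_reg_r with (Cmod (v - z)); [lra|].
      unfold Rdiv; rewrite Rmult_assoc, Rinv_l, Rmult_1_r; lra.
Qed.

(** * Asymptotics of germs *)

Lemma near_and (P Q : C -> Prop) : near P -> near Q -> near (fun z => P z /\ Q z).
Proof.
  intros [d1 [H1 K1]] [d2 [H2 K2]].
  exists (Rmin d1 d2); split; [apply Rmin_glb_lt; auto|]; intros z Hz; split.
  - apply K1; eapply Rlt_le_trans; [exact Hz|apply Rmin_l].
  - apply K2; eapply Rlt_le_trans; [exact Hz|apply Rmin_r].
Qed.

Lemma near_imp (P Q : C -> Prop) : (forall z, P z -> Q z) -> near P -> near Q.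
Proof. intros H [d [Hd K]]; exists d; auto. Qed.

Lemma near_at_0 (P : C -> Prop) : near P -> P 0.
Proof. intros [d [Hd K]]; apply K; rewrite Cmod_0; auto. Qed.

Lemma near_comp (P : C -> Prop) (u : C -> C) :
  near P -> ccont u 0 -> u 0 = 0 -> near (fun z => P (u z)).
Proof.
  intros [d [Hd K]] Cu U0.
  destruct (Cu d Hd) as [d' [Hd' L]].
  exists d'; split; auto; intros z Hz; apply K.
  rewrite U0 in L; specialize (L z).
  replace (z - 0)%C with z in L by ring; replace (u z - 0)%C with (u z) in L by ring.
  auto.
Qed.

Lemma near_lt (e : R) : 0 < e -> near (fun z => Cmod z < e).
Proof. intros He; exists e; split; auto. Qed.

Lemma ccont_near_bound (h : C -> C) :
  ccont h 0 -> near (fun z => Cmod (h z) <= Cmod (h 0) + 1).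
Proof.
  intros Ch; destruct (Ch 1) as [d [Hd L]]; [lra|].
  exists d; split; auto; intros z Hz; specialize (L z).
  replace (z - 0)%C with z in L by ring; specialize (L Hz).
  pose proof (Cmod_triangle_rev (h z) (h 0)); lra.
Qed.

Lemma ccont_pow (f : C -> C) (n : nat) (z : C) :
  ccont f z -> ccont (fun w => f w ^ n)%C z.
Proof.
  intros H; induction n as [|n IH]; [exact (ccont_const 1 z)|].
  exact (ccont_mult f (fun w => f w ^ n)%C z H IH).
Qed.

(** [asy f n c] says [f z = c z^n + o(z^n)]; writing the right-hand side as
    [h z * z^n] with [h] continuous reduces the calculus to that of limits. *)
Definition asy (f : C -> C) (n : nat) (c : C) : Prop :=
  exists h : C -> C, ccont h 0 /\ h 0 = c /\ near (fun z => f z = (h z * z ^ n)%C).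

Lemma asy_ext_near (f g : C -> C) (n : nat) (c : C) :
  near (fun z => f z = g z) -> asy f n c -> asy g n c.
Proof.
  intros E [h [Ch [H0 Hf]]]; exists h; repeat split; auto.
  apply (near_imp (fun z => f z = g z /\ f z = h z * z ^ n)%C).
  - intros z [E1 E2]; congruence.
  - apply near_and; auto.
Qed.

Lemma asy_plus (f g : C -> C) (n : nat) (c d : C) :
  asy f n c -> asy g n d -> asy (fun z => f z + g z)%C n (c + d).
Proof.
  intros [h [Ch [H0 Hf]]] [k [Ck [K0 Hg]]].
  exists (fun z => h z + k z)%C; split; [apply ccont_plus; auto|split].
  - congruence.
  - eapply near_imp; [|apply (near_and _ _ Hf Hg)].
    intros z [-> ->]; ring.
Qed.

Lemma asy_mult (f g : C -> C) (n m : nat) (c d : C) :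
  asy f n c -> asy g m d -> asy (fun z => f z * g z)%C (n + m) (c * d).
Proof.
  intros [h [Ch [H0 Hf]]] [k [Ck [K0 Hg]]].
  exists (fun z => h z * k z)%C; split; [apply ccont_mult; auto|split].
  - congruence.
  - eapply near_imp; [|apply (near_and _ _ Hf Hg)].
    intros z [-> ->]; rewrite Cpow_add_r; ring.
Qed.

Lemma asy_scal (k : C) (f : C -> C) (n : nat) (c : C) :
  asy f n c -> asy (fun z => k * f z)%C n (k * c).
Proof.
  intros H; apply (asy_mult (fun _ => k) f 0 n); auto.
  exists (fun _ => k); split; [apply ccont_const|split; auto].
  exists 1; split; [lra|]; intros; simpl; ring.
Qed.

Lemma asy_pow (f : C -> C) (c : C) (m : nat) :
  asy f 1 c -> asy (fun z => f z ^ m)%C m (c ^ m).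
Proof.
  intros [h [Ch [H0 Hf]]].
  exists (fun z => h z ^ m)%C; split; [apply ccont_pow; auto|split].
  - congruence.
  - eapply near_imp; [|exact Hf]; intros z ->.
    rewrite Cpow_1_r, Cpow_mult_l; auto.
Qed.

Lemma asy_id : asy (fun z => z) 1 1.
Proof.
  exists (fun _ => RtoC 1); split; [apply ccont_const|split; auto].
  exists 1; split; [lra|]; intros; simpl; ring.
Qed.

Lemma asy_weaken (f : C -> C) (n : nat) (c : C) :
  asy f (S n) c -> asy f n 0.
Proof.
  intros [h [Ch [H0 Hf]]].
  exists (fun z => h z * z)%C; split; [apply ccont_mult; [auto|apply ccont_id]|split].
  - ring.
  - eapply near_imp; [|exact Hf]; intros z ->; rewrite Cpow_S; ring.
Qed.

Lemma asy_weaken_lt (f : C -> C) (n m : nat) (c : C) :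
  (m < n)%nat -> asy f n c -> asy f m 0.
Proof.
  intros L; revert c; induction L as [|n L IH]; intros c H.
  - exact (asy_weaken _ _ _ H).
  - exact (IH _ (asy_weaken _ _ _ H)).
Qed.

Lemma asy_zero (f : C -> C) (n : nat) (c : C) :
  near (fun z => f z = 0) -> asy f n c -> c = 0.
Proof.
  intros F0 [h [Ch [H0 Hf]]].
  assert (Z : near (fun z => z <> 0 -> h z = 0)).
  { eapply near_imp; [|apply (near_and _ _ F0 Hf)].
    intros z [E1 E2] Nz; rewrite E1 in E2.
    replace (h z) with (h z * z ^ n * / z ^ n)%C
      by (field; apply Cpow_nz; auto).
    rewrite <- E2; ring. }
  destruct Z as [d [Hd Z]].
  rewrite <- H0; symmetry; apply Cmod_eq_eps; intros e He.
  destruct (Ch e He) as [d' [Hd' L]].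
  set (t := Rmin d d' / 2).
  assert (Hm : 0 < Rmin d d') by (apply Rmin_glb_lt; auto).
  pose proof (Rmin_l d d'); pose proof (Rmin_r d d').
  assert (Ht : Cmod t = t) by (rewrite Cmod_R, Rabs_pos_eq; unfold t; lra).
  assert (Nt : RtoC t <> 0) by (apply Cmod_pos_neq; rewrite Ht; unfold t; lra).
  replace (0 - h 0)%C with (h t - h 0)%C
    by (rewrite (Z t) by (auto; rewrite Ht; unfold t; lra); auto).
  apply Rlt_le, L; replace (t - 0)%C with (RtoC t) by ring.
  rewrite Ht; unfold t; lra.
Qed.

Lemma asy_unique (f g : C -> C) (n : nat) (c d : C) :
  near (fun z => f z = g z) -> asy f n c -> asy g n d -> c = d.
Proof.
  intros E Hf Hg; apply Ceq_minus.
  apply (asy_zero (fun z => f z + - (1) * g z)%C n).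
  - eapply near_imp; [|exact E]; intros z ->; ring.
  - replace (c - d)%C with (c + - (1) * d)%C by ring.
    apply asy_plus; auto; apply asy_scal; auto.
Qed.

Lemma asy_ccont (f : C -> C) (n : nat) (c : C) :
  asy f (S n) c -> ccont f 0 /\ f 0 = 0.
Proof.
  intros [h [Ch [H0 [d [Hd Hf]]]]]; split.
  - apply (ccont_ext_near (fun z => h z * z ^ S n)%C _ _ d); auto.
    + intros w Hw; symmetry; apply Hf.
      replace (w - 0)%C with w in Hw by ring; auto.
    + apply ccont_mult; [auto|apply ccont_pow, ccont_id].
  - rewrite Hf by (rewrite Cmod_0; auto); rewrite Cpow_S; ring.
Qed.

Lemma asy_comp (f u : C -> C) (n : nat) (c d : C) :
  asy f n c -> asy u 1 d -> asy (fun z => f (u z)) n (c * d ^ n).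
Proof.
  intros [h [Ch [H0 Hf]]] Hu; destruct (asy_ccont _ _ _ Hu) as [Cu U0].
  destruct Hu as [k [Ck [K0 Hk]]].
  exists (fun z => h (u z) * k z ^ n)%C; split; [|split].
  - apply ccont_mult; [|apply ccont_pow; auto].
    apply (ccont_comp h u); [auto|rewrite U0; auto].
  - rewrite U0; congruence.
  - eapply near_imp; [|apply (near_and _ _ Hk (near_comp _ _ Hf Cu U0))].
    intros z [E1 ->]; rewrite E1 at 2; rewrite Cpow_mult_l, Cpow_1_r; ring.
Qed.

Lemma asy_of_little_o (f : C -> C) (n : nat) (c : C) :
  (forall eps, 0 < eps -> near (fun z => Cmod (f z - c * z ^ n) <= eps * Cmod z ^ n)) ->
  asy f n c.
Proof.
  intros H.
  exists (fun z : C => if excluded_middle_informative (z = 0) then c else (f z / z ^ n)%C).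
  split; [|split].
  - intros e He.
    destruct (H (e / 2)) as [d [Hd L]]; [lra|].
    exists d; split; auto; intros w Hw.
    replace (w - 0)%C with w in Hw by ring.
    destruct (excluded_middle_informative (RtoC 0 = 0)); [|congruence].
    destruct (excluded_middle_informative (w = 0)) as [E|N].
    + rewrite Cmod_minus_diag; auto.
    + specialize (L w Hw).
      assert (Np : (w ^ n)%C <> 0) by (apply Cpow_nz; auto).
      replace (f w / w ^ n - c)%C with ((f w - c * w ^ n) / w ^ n)%C by (field; auto).
      assert (P : 0 < Cmod (w ^ n)) by (apply Cmod_gt_0; auto).
      rewrite Cmod_div by auto.
      apply Rle_lt_trans with (e / 2); [|lra].
      apply Rmult_le_reg_r with (Cmod (w ^ n)); auto.
      unfold Rdiv at 1; rewrite Rmult_assoc, Rinv_l, Rmult_1_r by lra.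
      rewrite Cmod_pow; exact L.
  - destruct (excluded_middle_informative (RtoC 0 = 0)); congruence.
  - exists 1; split; [lra|]; intros z _.
    destruct (excluded_middle_informative (z = 0)) as [->|N].
    (* At the origin the hypothesis itself forces [f 0 = c * 0 ^ n], where [0 ^ 0] is 1. *)
    + apply Cmod_eq_eps; intros e He.
      assert (L := near_at_0 _ (H e He)); simpl in L.
      eapply Rle_trans; [exact L|]; rewrite Cmod_0.
      destruct n as [|n]; [simpl; lra|rewrite pow_i by lia; lra].
    + field; apply Cpow_nz; auto.
Qed.

Lemma asy_of_big_O (f : C -> C) (n : nat) (c : C) (K : R) :
  near (fun z => Cmod (f z - c * z ^ n) <= K * Cmod z ^ S n) -> asy f n c.
Proof.
  intros H; apply asy_of_little_o; intros e He.
  set (K' := Rmax K 1).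
  assert (HK : K <= K') by apply Rmax_l.
  assert (HK1 : 1 <= K') by apply Rmax_r.
  assert (Hd : 0 < e / K') by (apply Rdiv_lt_0_compat; lra).
  eapply near_imp; [|apply (near_and _ _ H (near_lt _ Hd))].
  intros z [L Hz]; eapply Rle_trans; [exact L|].
  assert (P : 0 <= Cmod z ^ n) by (apply pow_le, Cmod_ge_0).
  pose proof (Cmod_ge_0 z).
  simpl pow; rewrite <- Rmult_assoc; apply Rmult_le_compat_r; auto.
  apply Rle_trans with (K' * Cmod z); [apply Rmult_le_compat_r; auto|].
  replace e with (K' * (e / K')) by (field; lra).
  apply Rmult_le_compat_l; lra.
Qed.

Lemma leading_asy (f : C -> C) (m : nat) (b : C) : leading f m b -> asy f m b.
Proof.
  intros [F0 [K [e [HK [He L]]]]].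
  apply asy_of_big_O with K; exists e; split; auto; intros z Hz.
  assert (Z : Cmod 0 < e) by (rewrite Cmod_0; auto).
  specialize (L 0 z Z Hz).
  rewrite F0, Cmod_0, Rmax_right in L by apply Cmod_ge_0.
  replace (f z - b * z ^ m - (b * 0 ^ m - b * 0 ^ m))%C with (f z - b * z ^ m)%C in L by ring.
  replace (z - 0)%C with z in L by ring.
  simpl pow; replace (K * (Cmod z * Cmod z ^ m)) with (K * Cmod z ^ m * Cmod z) by ring.
  exact L.
Qed.

(** The derivative of the power shows as the factor [S m], obtained by telescoping [u * (u ^ S m - v
    ^ S m) + (u - v) * v ^ S m]. *)
Lemma asy_pow_minus (u v : C -> C) (n m : nat) (e : C) :
  asy u 1 1 -> asy v 1 1 -> asy (fun z => u z - v z)%C n e ->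
  asy (fun z => u z ^ S m - v z ^ S m)%C (m + n) (INR (S m) * e).
Proof.
  intros Hu Hv He; induction m as [|m IH].
  - apply (asy_ext_near (fun z => u z - v z)%C).
    + exists 1; split; [lra|]; intros; simpl; ring.
    + simpl; replace (1 * e)%C with e by ring; auto.
  - apply (asy_ext_near
      (fun z => u z * (u z ^ S m - v z ^ S m) + (u z - v z) * v z ^ S m)%C).
    + exists 1; split; [lra|]; intros; rewrite !(Cpow_S _ (S m)); ring.
    + rewrite (S_INR (S m)), RtoC_plus.
      replace ((INR (S m) + 1) * e)%C with (1 * (INR (S m) * e) + e * 1 ^ S m)%C
        by (rewrite Cpow_1_l; ring).
      apply asy_plus; [exact (asy_mult _ _ _ _ _ _ Hu IH)|].
      replace (S m + n)%nat with (n + S m)%nat by lia.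
      apply asy_mult; auto; apply asy_pow; auto.
Qed.

(** Morally [k (u z) - k (v z)] is [k'(z) * (u z - v z)], with [k'] starting at
    [INR (S m) * b * z ^ m]. No derivative is taken: the increment bound in [leading] makes the
    contribution of the remainder smaller by one full order. *)
Lemma leading_increment (k u v : C -> C) (m n : nat) (b e : C) :
  leading k (S m) b -> asy u 1 1 -> asy v 1 1 -> asy (fun z => u z - v z)%C n e ->
  asy (fun z => k (u z) - k (v z))%C (m + n) (INR (S m) * b * e).
Proof.
  intros [K0 [K [ep [HK [Hep L]]]]] Hu Hv He.
  set (rem := fun z => ((k (u z) - b * u z ^ S m) - (k (v z) - b * v z ^ S m))%C).
  apply (asy_ext_near (fun z => b * (u z ^ S m - v z ^ S m) + rem z)%C).
  { exists 1; split; [lra|]; intros; unfold rem; ring. }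
  replace (INR (S m) * b * e)%C with (b * (INR (S m) * e) + 0)%C by ring.
  apply asy_plus; [apply asy_scal, asy_pow_minus; auto|].
  destruct (asy_ccont _ _ _ Hu) as [Cu U0]; destruct (asy_ccont _ _ _ Hv) as [Cv V0].
  destruct Hu as [h [Ch [H0 Hu]]]; destruct Hv as [h' [Ch' [H0' Hv]]].
  destruct He as [d [Cd [D0 Hd]]].
  (* Near 0 both [u z] and [v z] are at most [2 * Cmod z], and their difference is at most
     [(Cmod e + 1) * Cmod z ^ n]. *)
  apply asy_of_big_O with (K * 2 ^ S m * (Cmod e + 1)).
  assert (B1 := ccont_near_bound _ Ch); assert (B2 := ccont_near_bound _ Ch').
  assert (B3 := ccont_near_bound _ Cd).
  rewrite H0, Cmod_1 in B1; rewrite H0', Cmod_1 in B2; rewrite D0 in B3.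
  assert (L1 := near_comp _ _ (near_lt _ Hep) Cu U0).
  assert (L2 := near_comp _ _ (near_lt _ Hep) Cv V0).
  eapply near_imp; [|exact (near_and _ _ (near_and _ _ (near_and _ _ Hu Hv) (near_and _ _ B1 B2))
    (near_and _ _ (near_and _ _ Hd B3) (near_and _ _ L1 L2)))].
  intros z [[[E1 E2] [M1 M2]] [[E3 M3] [S1 S2]]]; simpl in S1, S2.
  replace (rem z - 0 * z ^ (m + n))%C with (rem z) by ring.
  assert (P := L (v z) (u z) S2 S1); fold (rem z) in P.
  eapply Rle_trans; [exact P|].
  rewrite E3, Cmod_mult, Cmod_pow.
  assert (Q : Rmax (Cmod (v z)) (Cmod (u z)) <= 2 * Cmod z).
  { apply Rmax_lub; [rewrite E2|rewrite E1]; rewrite Cpow_1_r, Cmod_mult;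
      apply Rmult_le_compat_r; try apply Cmod_ge_0; lra. }
  assert (Q' : Rmax (Cmod (v z)) (Cmod (u z)) ^ S m <= (2 * Cmod z) ^ S m).
  { apply pow_incr; split; auto.
    eapply Rle_trans; [apply Cmod_ge_0|apply Rmax_l]. }
  rewrite Rpow_mult_distr in Q'.
  assert (Pn : 0 <= Cmod z ^ n) by (apply pow_le, Cmod_ge_0).
  replace (K * 2 ^ S m * (Cmod e + 1) * Cmod z ^ S (m + n))
    with (K * (2 ^ S m * Cmod z ^ S m) * ((Cmod e + 1) * Cmod z ^ n)).
  2:{ replace (S (m + n)) with (S m + n)%nat by lia; rewrite pow_add; ring. }
  apply Rmult_le_compat.
  - apply Rmult_le_pos; auto; apply pow_le.
    eapply Rle_trans; [apply Cmod_ge_0|apply Rmax_l].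
  - apply Rmult_le_pos; auto; apply Cmod_ge_0.
  - apply Rmult_le_compat_l; auto.
  - apply Rmult_le_compat_r; auto.
Qed.

Lemma asy_1_cderiv (f : C -> C) (c : C) :
  f 0 = 0 -> cderiv f 0 c -> asy f 1 c.
Proof.
  intros F0 D; apply cderiv_caratheodory in D; destruct D as [h [Ch [H0 Hf]]].
  exists h; repeat split; auto.
  exists 1; split; [lra|]; intros z _; rewrite (Hf z), F0; simpl; ring.
Qed.

(** * Leading coefficients in functional equations between germs *)

Definition perturbation (f : C -> C) : C -> C := fun z => (f z - z)%C.

Lemma perturbation_asy_1 (f : C -> C) (p : nat) (b : C) :
  leading (perturbation f) (S (S p)) b -> asy f 1 1.
Proof.
  intros H; apply leading_asy in H.
  apply (asy_ext_near (fun z => z + perturbation f z)%C).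
  { exists 1; split; [lra|]; intros; unfold perturbation; ring. }
  replace (RtoC 1) with (1 + 0)%C by ring.
  apply asy_plus; [apply asy_id|].
  apply (asy_weaken_lt _ (S (S p)) 1 b); auto; lia.
Qed.

Lemma increment_perturbation (k f : C -> C) (m p : nat) (b c : C) :
  leading k (S m) c -> leading (perturbation f) (S (S p)) b ->
  asy (fun z => k (f z) - k z)%C (m + S (S p)) (INR (S m) * c * b).
Proof.
  intros Hk Hf; apply (leading_increment k f (fun z => z)); auto.
  - apply (perturbation_asy_1 f p b); auto.
  - apply asy_id.
  - apply leading_asy; auto.
Qed.

(** The relation says that [perturbation f (g (f z))] and [g (f z) - g z] cancel. Their leading
    coefficients at the common order are [b * l ^ S (S p)] and [l * b]. *)
Lemma reverser_multiplier (f g : C -> C) (p : nat) (b l : C) :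
  leading (perturbation f) (S (S p)) b -> b <> 0 ->
  leading g 1 l -> l <> 0 ->
  near (fun z => f (g (f z)) = g z) ->
  (l ^ S p = - (1))%C.
Proof.
  intros Hf Nb Hg Nl E.
  assert (A1 := increment_perturbation g f 0 p b l Hg Hf).
  assert (A2 : asy (fun z => perturbation f (g (f z))) (S (S p)) (b * l ^ S (S p))%C).
  { apply (asy_comp (perturbation f) (fun z => g (f z))); [apply leading_asy; auto|].
    replace l with (l * 1 ^ 1)%C by (rewrite Cpow_1_l; ring).
    apply (asy_comp g f); [apply leading_asy; auto|].
    apply (perturbation_asy_1 f p b); auto. }
  assert (Z := asy_plus _ _ _ _ _ A2 A1).
  apply asy_zero in Z.
  - rewrite Cpow_S in Z; simpl INR in Z.
    assert (Z' : (b * l * (l ^ S p + 1))%C = 0) by (rewrite <- Z; ring).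
    apply Ceq_minus; replace (l ^ S p - - (1))%C with (l ^ S p + 1)%C by ring.
    apply NNPP; intros N; revert Z'; repeat apply Cmult_neq_0; auto.
  - eapply near_imp; [|exact E]; intros z Ez; simpl.
    unfold perturbation; rewrite Ez; ring.
Qed.

(** For commuting germs the increment of [perturbation f] along [k] equals that of [perturbation k]
    along [f]. Both have the same order, and their coefficients [INR (S (S p)) * b * c] and
    [INR (S (S q)) * c * b] force [p = q]. *)
Lemma commuting_same_order (f k : C -> C) (p q : nat) (b c : C) :
  leading (perturbation f) (S (S p)) b -> b <> 0 ->
  leading (perturbation k) (S (S q)) c -> c <> 0 ->
  near (fun z => f (k z) = k (f z)) -> p = q.
Proof.
  intros Hf Nb Hk Nc E.
  assert (A1 := increment_perturbation _ k (S p) q c b Hf Hk).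
  assert (A2 := increment_perturbation _ f (S q) p b c Hk Hf).
  replace (S q + S (S p))%nat with (S p + S (S q))%nat in A2 by lia.
  assert (U : (INR (S (S p)) * b * c)%C = (INR (S (S q)) * c * b)%C).
  { eapply asy_unique; [|exact A1|exact A2].
    eapply near_imp; [|exact E]; intros z Ez; unfold perturbation.
    rewrite Ez; ring. }
  assert (U' : ((INR (S (S p)) - INR (S (S q))) * (b * c))%C = 0).
  { replace ((INR (S (S p)) - INR (S (S q))) * (b * c))%C
      with (INR (S (S p)) * b * c - INR (S (S q)) * c * b)%C by ring.
    rewrite U; ring. }
  rewrite <- RtoC_minus in U'.
  destruct (Nat.eq_dec p q) as [|N]; auto; exfalso; revert U'.
  apply Cmult_neq_0; [|apply Cmult_neq_0; auto].
  intros H; apply RtoC_inj in H.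
  apply N; apply Rminus_diag_uniq in H; apply INR_eq in H; lia.
Qed.

(** Subtracting [g z] from both sides compares [perturbation k (g z)], with coefficient
    [c * l ^ S (S q)], to the increment of [g] along [k], with coefficient [l * c]. *)
Lemma commuting_multiplier (g k : C -> C) (q : nat) (c l : C) :
  leading (perturbation k) (S (S q)) c -> c <> 0 ->
  leading g 1 l -> l <> 0 ->
  near (fun z => k (g z) = g (k z)) ->
  (l ^ S q = 1)%C.
Proof.
  intros Hk Nc Hg Nl E.
  assert (A1 := increment_perturbation g k 0 q c l Hg Hk).
  assert (A2 : asy (fun z => perturbation k (g z)) (S (S q)) (c * l ^ S (S q))%C)
    by (apply asy_comp; apply leading_asy; auto).
  assert (U : (INR 1 * l * c)%C = (c * l ^ S (S q))%C).
  { eapply asy_unique; [|exact A1|exact A2].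
    eapply near_imp; [|exact E]; intros z Ez; unfold perturbation.
    rewrite Ez; ring. }
  rewrite Cpow_S in U; simpl INR in U.
  assert (U' : (c * l * (l ^ S q - 1))%C = 0).
  { replace (c * l * (l ^ S q - 1))%C with (c * (l * l ^ S q) - 1 * l * c)%C by ring.
    rewrite U; ring. }
  apply Ceq_minus, NNPP; intros N; revert U'; repeat apply Cmult_neq_0; auto.
Qed.

(** * Derivative towers and multipliers *)

(** Here [proj] stands for the real or the imaginary part: the mean value theorem holds only for
    real functions, so it is applied to each part along the segment from 0 to [z]. *)
Lemma radial_derive (proj : C -> R) (psi : C -> C) (z l : C) (t : R) :
  (forall u v, proj (u - v)%C = proj u - proj v) ->
  (forall (x : R) u, proj (x * u)%C = x * proj u) ->
  (forall u, Rabs (proj u) <= Cmod u) ->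
  cderiv psi (t * z)%C l ->
  is_derive (fun s : R => proj (psi (s * z)%C)) t (proj (l * z)%C).
Proof.
  intros Pm Ps Pb D; apply is_derive_Reals; intros e He.
  pose proof (Cmod_ge_0 z).
  destruct (proj1 (cderiv_eps _ _ _) D (e / 2 / (Cmod z + 1))) as [d [Hd L]].
  { repeat apply Rdiv_lt_0_compat; lra. }
  assert (Hd' : 0 < d / (Cmod z + 1)) by (apply Rdiv_lt_0_compat; lra).
  exists (mkposreal _ Hd'); simpl; intros s Ns Hs.
  set (D0 := (psi ((t + s)%R * z) - psi (t * z) - l * ((t + s)%R * z - t * z))%C).
  assert (E : ((t + s)%R * z - t * z)%C = (s * z)%C) by (rewrite RtoC_plus; ring).
  assert (HL : Cmod D0 <= e / 2 / (Cmod z + 1) * (Rabs s * Cmod z)).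
  { unfold D0; rewrite <- Cmod_R, <- Cmod_mult, <- E; apply L; rewrite E.
    rewrite Cmod_mult, Cmod_R.
    apply Rle_lt_trans with (Rabs s * (Cmod z + 1)).
    - apply Rmult_le_compat_l; [apply Rabs_pos|lra].
    - replace d with (d / (Cmod z + 1) * (Cmod z + 1)) by (field; lra).
      apply Rmult_lt_compat_r; lra. }
  assert (EP : proj (psi ((t + s)%R * z)%C) - proj (psi (t * z)%C)
               = proj D0 + s * proj (l * z)%C).
  { unfold D0; rewrite E.
    replace (l * (s * z))%C with (s * (l * z))%C by ring.
    rewrite !Pm, Ps; ring. }
  rewrite EP.
  replace ((proj D0 + s * proj (l * z)%C) / s - proj (l * z)%C)
    with (proj D0 / s) by (field; auto).
  unfold Rdiv; rewrite Rabs_mult, Rabs_inv.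
  assert (Hs0 : 0 < Rabs s) by (apply Rabs_pos_lt; auto).
  apply Rmult_lt_reg_r with (Rabs s); auto.
  rewrite Rmult_assoc, Rinv_l, Rmult_1_r by lra.
  eapply Rle_lt_trans; [apply Pb|].
  eapply Rle_lt_trans; [exact HL|].
  apply Rle_lt_trans with (e / 2 * Rabs s).
  - replace (e / 2 / (Cmod z + 1) * (Rabs s * Cmod z))
      with (e / 2 * Rabs s * (Cmod z / (Cmod z + 1))) by (field; lra).
    rewrite <- (Rmult_1_r (e / 2 * Rabs s)) at 2.
    apply Rmult_le_compat_l; [apply Rmult_le_pos; lra|].
    apply Rmult_le_reg_r with (Cmod z + 1); [lra|].
    unfold Rdiv; rewrite Rmult_assoc, Rinv_l, Rmult_1_r; lra.
  - apply Rmult_lt_compat_r; lra.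
Qed.

Lemma mean_value_bound (psi dpsi : C -> C) (z : C) (M : R) :
  (forall w, Cmod w <= Cmod z -> cderiv psi w (dpsi w) /\ Cmod (dpsi w) <= M) ->
  Cmod (psi z - psi 0) <= 2 * M * Cmod z.
Proof.
  intros H.
  assert (Main : forall proj : C -> R,
    (forall u v, proj (u - v)%C = proj u - proj v) ->
    (forall (x : R) u, proj (x * u)%C = x * proj u) ->
    (forall u, Rabs (proj u) <= Cmod u) ->
    Rabs (proj (psi z - psi 0)%C) <= M * Cmod z).
  { intros proj Pm Ps Pb; rewrite Pm.
    assert (B := bounded_variation (fun s : R => proj (psi (s * z)%C))
      (fun s : R => proj (dpsi (s * z) * z)%C) (M * Cmod z) 0 1).
    simpl in B.
    rewrite Rminus_0_r, Rabs_R1, Rmult_1_r, Cmult_1_l, Cmult_0_l in B.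
    apply B; intros t Ht; rewrite Rminus_0_r in Ht.
    assert (Ct : Cmod (t * z) <= Cmod z).
    { rewrite Cmod_mult, Cmod_R; rewrite <- (Rmult_1_l (Cmod z)) at 2.
      apply Rmult_le_compat_r; [apply Cmod_ge_0|auto]. }
    destruct (H _ Ct) as [D L]; split.
    - apply radial_derive; auto.
    - eapply Rle_trans; [apply Pb|]; rewrite Cmod_mult.
      apply Rmult_le_compat_r; [apply Cmod_ge_0|auto]. }
  eapply Rle_trans; [apply Cmod_le_abs|].
  assert (M1 : Rabs (fst (psi z - psi 0)%C) <= M * Cmod z).
  { apply (Main fst).
    - intros u v; unfold Cminus, Cplus, Copp; simpl; ring.
    - intros x u; unfold Cmult, RtoC; simpl; ring.
    - exact re_le_Cmod. }
  assert (M2 : Rabs (snd (psi z - psi 0)%C) <= M * Cmod z).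
  { apply (Main snd).
    - intros u v; unfold Cminus, Cplus, Copp; simpl; ring.
    - intros x u; unfold Cmult, RtoC; simpl; ring.
    - exact im_le_Cmod. }
  lra.
Qed.

Lemma cderiv_pow (n : nat) (z : C) :
  cderiv (fun w => w ^ S n)%C z (INR (S n) * z ^ n)%C.
Proof.
  induction n as [|n IH].
  - apply (cderiv_ext_near (fun w => w) _ _ _ 1); [lra|intros; simpl; ring|].
    simpl; replace (1 * 1)%C with (RtoC 1) by ring; apply cderiv_id.
  - assert (D := cderiv_mult _ _ _ _ _ (cderiv_id z) IH).
    replace (INR (S (S n)) * z ^ S n)%C
      with (1 * z ^ S n + z * (INR (S n) * z ^ n))%C; [exact D|].
    rewrite (S_INR (S n)), RtoC_plus, !Cpow_S; ring.
Qed.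

(** Taylor's formula with Peano remainder. By induction the shifted tower expands the derivative,
    and the mean value bound integrates that expansion. This links the derivatives in [inGp] to
    leading coefficients. *)
Lemma tower_asy (n : nat) : forall (E : nat -> C -> C) (eps : R), 0 < eps ->
  (forall k z, Cmod z < eps -> cderiv (E k) z (E (S k) z)) ->
  (forall k, (k < n)%nat -> E k 0 = 0) ->
  asy (E O) n (E n 0 / INR (fact n))%C.
Proof.
  induction n as [|n IH]; intros E eps He HT H0.
  - exists (E O); split; [|split].
    + eapply cderiv_ccont, HT; rewrite Cmod_0; auto.
    + simpl; field.
    + exists 1; split; [lra|]; intros; simpl; ring.
  - assert (A := IH (fun k => E (S k)) eps He (fun k z Hz => HT (S k) z Hz)
      (fun k Hk => H0 (S k) ltac:(lia))).
    simpl in A.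
    set (c' := (E (S n) 0 / INR (fact n))%C) in A.
    set (c := (E (S n) 0 / INR (fact (S n)))%C).
    assert (Nf : RtoC (INR (fact n)) <> 0)
      by (intros Q; apply RtoC_inj in Q; revert Q; apply INR_fact_neq_0).
    assert (Ns : RtoC (INR (S n)) <> 0)
      by (intros Q; apply RtoC_inj in Q; revert Q; apply not_0_INR; lia).
    assert (Hc : c' = (c * INR (S n))%C).
    { unfold c, c'.
      change (fact (S n)) with (S n * fact n)%nat.
      rewrite mult_INR, RtoC_mult; field; auto. }
    apply asy_of_little_o; intros e Hepos.
    destruct A as [h [Ch [Hh Hf]]].
    destruct (Ch (e / 2)) as [d [Hd L]]; [lra|].
    assert (N1 : near (fun w => Cmod (E 1%nat w - c' * w ^ n) <= e / 2 * Cmod w ^ n)).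
    { eapply near_imp; [|apply (near_and _ _ Hf (near_lt _ Hd))].
      intros w [-> Hw].
      replace (h w * w ^ n - c' * w ^ n)%C with ((h w - h 0) * w ^ n)%C
        by (rewrite Hh; ring).
      rewrite Cmod_mult, Cmod_pow; apply Rmult_le_compat_r; [apply pow_le, Cmod_ge_0|].
      apply Rlt_le, L; replace (w - 0)%C with w by ring; auto. }
    destruct N1 as [d' [Hd' N1]].
    exists (Rmin eps d'); split; [apply Rmin_glb_lt; auto|]; intros z Hz.
    assert (Z1 : Cmod z < eps) by (eapply Rlt_le_trans; [exact Hz|apply Rmin_l]).
    assert (Z2 : Cmod z < d') by (eapply Rlt_le_trans; [exact Hz|apply Rmin_r]).
    (* Applied to [E O] minus its expected leading term, whose derivative is at most
       [e / 2 * Cmod w ^ n]; the factor 2 of the bound restores [e]. *)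
    assert (B := mean_value_bound (fun w => E O w - c * w ^ S n)%C
      (fun w => E 1%nat w - c * (INR (S n) * w ^ n))%C z (e / 2 * Cmod z ^ n)).
    simpl fact in B; cbv beta in B.
    rewrite (H0 O) in B by lia.
    replace (E O z - c * z ^ S n - (0 - c * 0 ^ S n))%C with (E O z - c * z ^ S n)%C in B
      by (rewrite !Cpow_S; ring).
    replace (e * Cmod z ^ S n) with (2 * (e / 2 * Cmod z ^ n) * Cmod z)
      by (simpl; field).
    apply B; intros w Hw; split.
    + apply cderiv_minus; [apply HT; lra|].
      replace (c * (INR (S n) * w ^ n))%C
        with (0 * w ^ S n + c * (INR (S n) * w ^ n))%C by ring.
      apply cderiv_mult; [apply cderiv_const|apply cderiv_pow].
    + replace (c * (INR (S n) * w ^ n))%C with (c' * w ^ n)%C by (rewrite Hc; ring).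
      eapply Rle_trans; [apply N1; lra|].
      apply Rmult_le_compat_l; [lra|]; apply pow_incr; split; [apply Cmod_ge_0|auto].
Qed.

(** The multiplier is named and its nonvanishing kept apart, so that multipliers of powers and
    composites are computed algebraically. *)
Definition hgerm (f : C -> C) (l : C) : Prop :=
  holo_near0 f /\ f 0 = 0 /\ cderiv f 0 l.

Lemma hgerm_asy (f : C -> C) (l : C) : hgerm f l -> asy f 1 l.
Proof. intros [_ [F0 D]]; apply asy_1_cderiv; auto. Qed.

Lemma hgerm_ccont (f : C -> C) (l : C) : hgerm f l -> ccont f 0.
Proof. intros [_ [_ D]]; eapply cderiv_ccont; eauto. Qed.

Lemma hgerm_0 (f : C -> C) (l : C) : hgerm f l -> f 0 = 0.
Proof. intros [_ [F0 _]]; auto. Qed.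

Lemma hgerm_near (f : C -> C) (l : C) (P : C -> Prop) :
  hgerm f l -> near P -> near (fun z => P (f z)).
Proof.
  intros H N; apply near_comp; auto; [eapply hgerm_ccont|eapply hgerm_0]; eauto.
Qed.

Lemma hgerm_inG (f : C -> C) (l : C) : hgerm f l -> l <> 0 -> inG f.
Proof. intros [Hh [F0 D]] N; split; [auto|split; [auto|exists l; auto]]. Qed.

Lemma inG_hgerm (f : C -> C) : inG f -> exists l : C, hgerm f l /\ l <> 0.
Proof. intros [Hh [F0 [l [D N]]]]; exists l; split; [split|]; auto. Qed.

Lemma hgerm_comp (f g : C -> C) (l m : C) :
  hgerm f l -> hgerm g m -> hgerm (Ccomp f g) (l * m).
Proof.
  intros Hf Hg; assert (Hf' := Hf); assert (Hg' := Hg).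
  destruct Hf' as [Nf [F0 Df]]; destruct Hg' as [Ng [G0 Dg]].
  split; [|split].
  - assert (N := near_and (fun z => cdiff g z) _ Ng (hgerm_near _ _ (fun z => cdiff f z) Hg Nf)).
    destruct N as [d [Hd N]]; exists d; split; auto; intros z Hz.
    destruct (N z Hz) as [[l1 D1] [l2 D2]].
    exists (l2 * l1)%C; exact (cderiv_comp f g z l2 l1 D1 D2).
  - unfold Ccomp; rewrite G0; auto.
  - apply (cderiv_comp f g); [auto|rewrite G0; auto].
Qed.

Lemma hgerm_id : hgerm Cid 1.
Proof.
  split; [|split; [auto|apply cderiv_id]].
  exists 1; split; [lra|]; intros z _; exists (RtoC 1); exact (cderiv_id z).
Qed.

Lemma hgerm_pow (g : C -> C) (l : C) (n : nat) :
  hgerm g l -> hgerm (germ_pow g n) (l ^ n).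
Proof.
  intros H; induction n as [|n IH]; [apply hgerm_id|].
  exact (hgerm_comp _ _ _ _ H IH).
Qed.

Lemma hgerm_perturbation (k : C -> C) : hgerm k 1 ->
  holo_near0 (perturbation k) /\ asy (perturbation k) 1 0.
Proof.
  intros H; split.
  - destruct H as [[d [Hd N]] _]; exists d; split; auto; intros z Hz.
    destruct (N z Hz) as [l D]; exists (l - 1)%C.
    exact (cderiv_minus _ _ _ _ _ D (cderiv_id z)).
  - apply (asy_ext_near (fun z => k z + - (1) * z)%C).
    + exists 1; split; [lra|]; intros; unfold perturbation; ring.
    + replace (RtoC 0) with (1 + - (1) * 1)%C by ring.
      apply asy_plus; [apply hgerm_asy; auto|apply asy_scal, asy_id].
Qed.

(** Upgrades an asymptotic to [leading]: holomorphy supplies some leading term with increment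
    control, and uniqueness identifies it with the known one. *)
Lemma leading_determined (f : C -> C) (m n : nat) (b c : C) :
  leading f m b -> b <> 0 -> asy f n c -> c <> 0 -> m = n /\ b = c.
Proof.
  intros Hl Nb Ha Nc; apply leading_asy in Hl.
  assert (Refl : near (fun z => f z = f z)) by (exists 1; split; [lra|auto]).
  destruct (Nat.lt_total m n) as [L|[->|L]].
  - exfalso; apply Nb, (asy_unique f f m); auto; eapply asy_weaken_lt; eauto.
  - split; auto; apply (asy_unique f f n); auto.
  - exfalso; apply Nc, (asy_unique f f n); auto; eapply asy_weaken_lt; eauto.
Qed.

Lemma hgerm_leading (g : C -> C) (l : C) : hgerm g l -> l <> 0 -> leading g 1 l.
Proof.
  intros H N; destruct (holo_zero_or_leading g (proj1 H)) as [Z|[m [b [Nb Hl]]]].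
  - exfalso; apply N; apply (asy_zero g 1); auto; apply hgerm_asy; auto.
  - destruct (leading_determined g m 1 b l Hl Nb (hgerm_asy _ _ H) N) as [-> ->]; auto.
Qed.

Lemma tangent_to_identity (k : C -> C) : hgerm k 1 ->
  germ_eq k Cid \/
  exists (q : nat) (c : C), c <> 0 /\ leading (perturbation k) (S (S q)) c.
Proof.
  intros H; destruct (hgerm_perturbation k H) as [Hh Ha].
  destruct (holo_zero_or_leading _ Hh) as [Z|[m [b [Nb Hl]]]].
  - left; eapply near_imp; [|exact Z]; intros z E; apply Ceq_minus; exact E.
  - right.
    assert (Hb := leading_asy _ _ _ Hl).
    assert (Refl : near (fun z => perturbation k z = perturbation k z))
      by (exists 1; split; [lra|auto]).
    destruct m as [|[|q]].
    + exfalso; apply Nb, (asy_unique _ _ _ _ _ Refl Hb), (asy_weaken _ _ _ Ha).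
    + exfalso; apply Nb, (asy_unique _ _ _ _ _ Refl Hb Ha).
    + exists q, b; auto.
Qed.

Lemma inAp_leading (p : nat) (f : C -> C) : inAp (S p) f ->
  hgerm f 1 /\ exists b : C, b <> 0 /\ leading (perturbation f) (S (S p)) b.
Proof.
  intros [[[HG H1] [D [eps [[He [HD0 HDS]] Hz]]]] HN].
  assert (Hf : hgerm f 1) by (destruct HG as [Hh [F0 _]]; split; auto).
  split; auto.
  assert (Z : Cmod 0 < eps) by (rewrite Cmod_0; auto).
  assert (D1 : D 1%nat 0 = 1).
  { apply (cderiv_unique f 0); auto.
    apply (cderiv_ext_near (D O) _ _ _ eps); auto.
    intros w Hw; apply HD0; replace (w - 0)%C with w in Hw by ring; auto. }
  (* The derivative tower of [f z - z], which departs from that of [f] only at levels 0 and 1. *)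
  set (E := fun k z => match k with
            | O => (D O z - z)%C | 1%nat => (D 1%nat z - 1)%C | _ => D k z end).
  assert (HE : forall k z, Cmod z < eps -> cderiv (E k) z (E (S k) z)).
  { intros [|[|k]] z Hzz; simpl.
    - apply cderiv_minus; [apply HDS; auto|apply cderiv_id].
    - replace (D 2%nat z) with (D 2%nat z - 0)%C by ring.
      apply cderiv_minus; [apply HDS; auto|apply cderiv_const].
    - apply HDS; auto. }
  assert (E0 : forall k, (k < S (S p))%nat -> E k 0 = 0).
  { intros [|[|k]] Hk; simpl.
    - rewrite HD0 by auto; rewrite (hgerm_0 _ _ Hf); ring.
    - rewrite D1; ring.
    - apply Hz; lia. }
  assert (A := tower_asy (S (S p)) E eps He HE E0).
  apply (asy_ext_near _ (perturbation f)) in A.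
  2:{ exists eps; split; auto; intros z Hzz; simpl.
      unfold perturbation; rewrite HD0; auto. }
  change (E (S (S p)) 0) with (D (S (S p)) 0) in A.
  set (c := (D (S (S p)) 0 / INR (fact (S (S p))))%C) in A.
  assert (Nc : c <> 0).
  { apply Cmult_neq_0.
    (* Were this derivative zero, the same tower would place [f] in the next group of the
       filtration. *)
    - intros Q; apply HN; split; [split; auto|].
      exists D, eps; split; [split; auto|].
      intros k Hk; destruct (Nat.eq_dec k (S (S p))) as [->|]; auto; apply Hz; lia.
    - intros Q.
      assert (Nf : RtoC (INR (fact (S (S p)))) <> 0)
        by (intros Q'; apply RtoC_inj in Q'; revert Q'; apply INR_fact_neq_0).
      assert (K := Cinv_r _ Nf); rewrite Q, Cmult_0_r in K.
      apply RtoC_inj in K; lra. }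
  exists c; split; auto.
  destruct (holo_zero_or_leading _ (proj1 (hgerm_perturbation f Hf)))
    as [Zf|[m [b [Nb Hl]]]].
  - exfalso; apply Nc, (asy_zero _ _ _ Zf A).
  - destruct (leading_determined _ _ _ _ _ Hl Nb A Nc) as [-> ->]; auto.
Qed.

(** The order [d] of [l] divides [2 * S p] but not [S p], so it is even, [d = 2 * s], and [s]
    divides [S p]. An even quotient would make [d] divide [S p]. *)
Lemma root_order (l : C) (p : nat) : (l ^ S p = - (1))%C ->
  exists s, (1 <= s)%nat /\ Nat.divide s (S p) /\ Nat.odd (S p / s) = true /\
    (l ^ (2 * s) = 1)%C /\ forall j, (0 < j < 2 * s)%nat -> (l ^ j)%C <> 1.
Proof.
  intros Hl.
  assert (Nm : (- (1))%C <> 1)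
    by (intros Q; injection Q; intros; lra).
  assert (Ex : exists d, (0 < d)%nat /\ (l ^ d)%C = 1).
  { exists (S p * 2)%nat; split; [lia|].
    rewrite Cpow_mult_r, Hl; simpl; ring. }
  destruct (dec_inh_nat_subset_has_unique_least_element
    (fun d => (0 < d)%nat /\ (l ^ d)%C = 1)) as [d [[[Hd Ed] Hmin] _]]; auto.
  { intros n; apply classic. }
  assert (Mul : forall c, (l ^ (d * c))%C = 1)
    by (intros c; rewrite Cpow_mult_r, Ed, Cpow_1_l; auto).
  assert (Div : forall n, (l ^ n)%C = 1 -> Nat.divide d n).
  { intros n Hn; rewrite (Nat.div_mod n d), Cpow_add_r, Mul, Cmult_1_l in Hn by lia.
    apply Nat.Lcm0.mod_divide.
    destruct (Nat.eq_dec (n mod d) 0) as [|N]; auto; exfalso.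
    assert (d <= n mod d)%nat by (apply Hmin; split; [lia|auto]).
    pose proof (Nat.mod_upper_bound n d); lia. }
  assert (NP : ~ Nat.divide d (S p)).
  { intros [c Hc]; rewrite Hc, Nat.mul_comm, Mul in Hl; auto. }
  assert (D2 : Nat.divide d (2 * S p)).
  { apply Div; rewrite Nat.mul_comm, Cpow_mult_r, Hl; simpl; ring. }
  destruct (Nat.Even_or_Odd d) as [[s Hs]|[s Hs]].
  - exists s; subst d.
    assert (Hs : (1 <= s)%nat) by lia.
    destruct D2 as [c Hc].
    assert (Hc' : S p = (c * s)%nat) by nia.
    split; [auto|split; [exists c; auto|split; [|split; auto]]].
    + rewrite Hc', Nat.div_mul by lia.
      destruct (Nat.Even_or_Odd c) as [[e He]|O]; [|apply Nat.odd_spec; auto].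
      exfalso; apply NP; exists e; rewrite Hc', He; lia.
    + intros j Hj Q; specialize (Hmin j (conj (proj1 Hj) Q)); lia.
  - exfalso; apply NP; destruct D2 as [c Hc].
    (* For odd [d = 2 * s + 1] and [2 * S p = c * d], this number is half of [c]. *)
    exists (S p - c * s)%nat; subst d; nia.
Qed.

(** * Reversibility *)

Lemma de_Moivre (t : R) (n : nat) :
  (((cos t, sin t) : C) ^ n)%C = (cos (INR n * t), sin (INR n * t)).
Proof.
  induction n as [|n IH].
  - simpl; rewrite Rmult_0_l, cos_0, sin_0; auto.
  - rewrite Cpow_S, IH, S_INR, Rmult_plus_distr_r, Rmult_1_l, cos_plus, sin_plus.
    unfold Cmult; simpl; f_equal; ring.
Qed.

Lemma unit_circle_angle (x y : R) :
  x * x + y * y = 1 -> exists t, x = cos t /\ y = sin t.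
Proof.
  intros H.
  assert (Hx : -1 <= x <= 1) by nra.
  assert (Hs : sqrt (1 - x²) = Rabs y).
  { rewrite <- sqrt_Rsqr_abs; f_equal; unfold Rsqr; lra. }
  destruct (Rle_dec 0 y) as [L|L].
  - exists (acos x); rewrite cos_acos, sin_acos, Hs, Rabs_pos_eq by auto; auto.
  - exists (- acos x); rewrite cos_neg, sin_neg, cos_acos, sin_acos, Hs by auto.
    rewrite Rabs_left by lra; split; ring.
Qed.

(** Puts the reverser in [inH]: [l] is unimodular, and the imaginary part of de Moivre's formula
    makes [S p] times its angle a multiple of pi. *)
Lemma root_angle (l : C) (p : nat) : (l ^ S p = - (1))%C ->
  exists (a : Z) (b : nat), (0 < b)%nat /\
    l = (cos (PI * (IZR a / INR b)), sin (PI * (IZR a / INR b))).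
Proof.
  intros Hl.
  assert (M : Cmod l = 1).
  { assert (Q : Cmod l ^ S p = 1) by (rewrite <- Cmod_pow, Hl, Cmod_opp, Cmod_1; auto).
    destruct (pow_R1 _ _ Q) as [E|E]; [|discriminate].
    rewrite Rabs_pos_eq in E by apply Cmod_ge_0; auto. }
  destruct l as [x y].
  assert (U : x * x + y * y = 1).
  { assert (Q := Cmod2_alt (x, y)); rewrite M in Q; simpl in Q; lra. }
  destruct (unit_circle_angle x y U) as [t [-> ->]].
  rewrite de_Moivre in Hl.
  assert (S0 := f_equal (@snd R R) Hl); unfold Copp, RtoC in S0; cbn [fst snd] in S0.
  rewrite Ropp_0 in S0.
  destruct (sin_eq_0_0 _ S0) as [k Hk].
  assert (HP : 0 < INR (S p)) by (apply lt_0_INR; lia).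
  exists k, (S p); split; [lia|].
  replace (PI * (IZR k / INR (S p))) with t; auto.
  apply Rmult_eq_reg_l with (INR (S p)); [|lra].
  rewrite Hk; field; lra.
Qed.

(** * Powers of a reverser and of germs with the same square *)

Lemma germ_pow_comm (g : C -> C) (n : nat) (z : C) :
  germ_pow g n (g z) = g (germ_pow g n z).
Proof. induction n as [|n IH]; simpl; unfold Ccomp; [auto|rewrite IH; auto]. Qed.

Lemma germ_pow_double_S (g : C -> C) (s : nat) :
  germ_pow g (2 * S s) = (fun z => g (g (germ_pow g (2 * s) z))).
Proof. replace (2 * S s)%nat with (S (S (2 * s))) by lia; reflexivity. Qed.

(** Since [g = f g f], one has [f g g = f g (f g f) = (f g f) g f = g g f]. *)
Lemma reverser_square_commutes (f g : C -> C) (l : C) :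
  hgerm f 1 -> hgerm g l -> near (fun z => f (g (f z)) = g z) ->
  near (fun z => f (g (g z)) = g (g (f z))).
Proof.
  intros Hf Hg E.
  assert (E' := hgerm_near _ _ _ (hgerm_comp _ _ _ _ Hg Hf) E); unfold Ccomp in E'.
  eapply near_imp; [|apply (near_and _ _ E E')].
  intros z [E1 E2]; rewrite <- E1 at 1; exact E2.
Qed.

Lemma reverser_even_power_commutes (f g : C -> C) (l : C) (s : nat) :
  hgerm f 1 -> hgerm g l -> near (fun z => f (g (f z)) = g z) ->
  near (fun z => f (germ_pow g (2 * s) z) = germ_pow g (2 * s) (f z)).
Proof.
  intros Hf Hg E; assert (Q := reverser_square_commutes f g l Hf Hg E).
  induction s as [|s IH].
  - exists 1; split; [lra|auto].
  - rewrite germ_pow_double_S.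
    eapply near_imp; [|exact (near_and _ _ IH (hgerm_near _ _ _ (hgerm_pow g l (2 * s) Hg) Q))].
    intros z [E1 E2]; cbv beta in E2; rewrite <- E1; exact E2.
Qed.

Lemma reverser_finite_order (f g : C -> C) (p s : nat) (b l : C) :
  hgerm f 1 -> leading (perturbation f) (S (S p)) b -> b <> 0 ->
  hgerm g l -> l <> 0 -> near (fun z => f (g (f z)) = g z) ->
  (l ^ (2 * s) = 1)%C -> germ_eq (germ_pow g (2 * s)) Cid.
Proof.
  intros Hf Lf Nb Hg Nl E Hl.
  assert (Hp := reverser_multiplier f g p b l Lf Nb (hgerm_leading g l Hg Nl) Nl E).
  assert (Hk := hgerm_pow g l (2 * s) Hg); rewrite Hl in Hk.
  destruct (tangent_to_identity _ Hk) as [Z|[q [c [Nc Lk]]]]; auto.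
  exfalso.
  assert (Q := reverser_even_power_commutes f g l s Hf Hg E).
  assert (Epq := commuting_same_order f _ p q b c Lf Nb Lk Nc Q).
  assert (Hq := commuting_multiplier g _ q c l Lk Nc (hgerm_leading g l Hg Nl) Nl).
  (* With equal orders, the same power of [l] is -1 by reversal and 1 by commutation. *)
  rewrite <- Epq, Hp in Hq.
  assert (H : (- (1))%C = 1).
  { apply Hq; exists 1; split; [lra|]; intros z _; apply germ_pow_comm. }
  injection H; intros; lra.
Qed.

Lemma germ_pow_square_eq (g h : C -> C) (l : C) (s : nat) :
  hgerm h l -> near (fun z => h (h z) = g (g z)) ->
  near (fun z => germ_pow h (2 * s) z = germ_pow g (2 * s) z).
Proof.
  intros Hh Q; induction s as [|s IH].
  - exists 1; split; [lra|auto].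
  - rewrite !germ_pow_double_S.
    eapply near_imp; [|exact (near_and _ _ IH (hgerm_near _ _ _ (hgerm_pow h l (2 * s) Hh) Q))].
    intros z [E1 E2]; cbv beta in E2; rewrite E2, E1; auto.
Qed.

(** Gives minimality of the order: a power of the germ below the order of [l] cannot be the
    identity. *)
Lemma germ_pow_id_multiplier (g : C -> C) (l : C) (n : nat) :
  hgerm g l -> germ_eq (germ_pow g n) Cid -> (l ^ n)%C = 1.
Proof.
  intros Hg E; apply (asy_unique (germ_pow g n) Cid 1 _ _ E).
  - apply hgerm_asy, hgerm_pow; auto.
  - apply asy_id.
Qed.

Lemma reversible_factorization (p : nat) (f : C -> C) :
  inAp (S p) f -> reversible f ->
  exists (g h ginv : C -> C) (s : nat),
    inH g /\ inH h /\ (1 <= s)%nat /\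
    has_order g (2 * s) /\ has_order h (2 * s) /\
    germ_eq (germ_pow g 2) (germ_pow h 2) /\
    Nat.divide s (S p) /\ Nat.odd (S p / s) = true /\
    germ_inv g ginv /\ germ_eq f (Ccomp ginv h).
Proof.
  intros HA [g [ginv [finv [HG [Ig [If R]]]]]].
  destruct (inAp_leading p f HA) as [Hf [b [Nb Lf]]].
  destruct (inG_hgerm g HG) as [l [Hg Nl]].
  assert (Hgf : hgerm (Ccomp g f) l).
  { replace l with (l * 1)%C by ring; apply hgerm_comp; auto. }
  assert (Hfgf : hgerm (Ccomp f (Ccomp g f)) l).
  { replace l with (1 * l)%C by ring; apply hgerm_comp; auto. }
  destruct Ig as [Ig1 Ig2]; destruct If as [If1 If2].
  (* The relation is composed with [f] on the right and [g] on the left. No regularity of [ginv] or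
     [finv] is given, so their identities are only pulled back along the holomorphic germs [f] and
     [f g f]. *)
  assert (E : near (fun z => f (g (f z)) = g z)).
  { assert (R' := hgerm_near _ _ _ Hf R).
    assert (I' := hgerm_near _ _ _ Hfgf Ig2).
    eapply near_imp; [|exact (near_and _ _ (near_and _ _ R' I') If1)].
    intros z [[E1 E2] E3]; unfold Ccomp, Cid in *; rewrite <- E2, E1, E3; auto. }
  assert (Hp := reverser_multiplier f g p b l Lf Nb (hgerm_leading g l Hg Nl) Nl E).
  destruct (root_order l p Hp) as [s [Hs [Ds [Os [Ls Ms]]]]].
  destruct (root_angle l p Hp) as [a [n [Hn Hl]]].
  assert (Og := reverser_finite_order f g p s b l Hf Lf Nb Hg Nl E Ls).
  assert (Sq : near (fun z => Ccomp g f (Ccomp g f z) = g (g z))).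
  { eapply near_imp; [|exact E]; intros z Ez; unfold Ccomp; rewrite Ez; auto. }
  assert (Oh : germ_eq (germ_pow (Ccomp g f) (2 * s)) Cid).
  { eapply near_imp; [|exact (near_and _ _ Og (germ_pow_square_eq g _ l s Hgf Sq))].
    intros z [E1 E2]; rewrite E2; exact E1. }
  exists g, (Ccomp g f), ginv, s.
  (* Because [f] has multiplier 1, [g] and [g f] share the multiplier [l], and one argument serves
     for both. *)
  assert (InH : forall k, hgerm k l -> inH k).
  { intros k Hk; split; [apply (hgerm_inG k l); auto|].
    exists a, n; split; auto; rewrite <- Hl; apply Hk. }
  assert (Ord : forall k, hgerm k l -> germ_eq (germ_pow k (2 * s)) Cid ->
            has_order k (2 * s)).
  { intros k Hk Ek; split; [lia|split; auto].
    intros j Hj Q; apply (Ms j Hj), (germ_pow_id_multiplier k l j Hk Q). }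
  refine (conj (InH g Hg) (conj (InH _ Hgf) (conj Hs (conj (Ord g Hg Og)
    (conj (Ord _ Hgf Oh) (conj _ (conj Ds (conj Os (conj (conj Ig1 Ig2) _))))))))).
  - eapply near_imp; [|exact Sq]; intros z Ez; symmetry; exact Ez.
  - eapply near_imp; [|exact (hgerm_near _ _ _ Hf Ig1)].
    intros z Ez; symmetry; exact Ez.
Qed.

Lemma factorization_reversible (f g h ginv : C -> C) (n : nat) :
  inG g -> inG h -> germ_eq (germ_pow h (S n)) Cid ->
  germ_eq (germ_pow g 2) (germ_pow h 2) ->
  germ_inv g ginv -> germ_eq f (Ccomp ginv h) -> reversible f.
Proof.
  intros HG HH Oh Sq [I1 I2] F.
  destruct (inG_hgerm g HG) as [l [Hg _]]; destruct (inG_hgerm h HH) as [m [Hh _]].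
  exists g, ginv, (Ccomp ginv (Ccomp f g)).
  split; [auto|split; [split; auto|split; [split|exists 1; split; [lra|auto]]]].
  - assert (N1 := hgerm_near _ _ _ Hh I2); assert (N2 := hgerm_near _ _ _ Hh F).
    assert (N3 := hgerm_near _ _ _ Hg I1).
    eapply near_imp; [|exact (near_and _ _ (near_and _ _ (near_and _ _ F Sq) (near_and _ _ N1 N2))
      (near_and _ _ N3 I1))].
    intros z [[[E1 E2] [E3 E4]] [E5 E6]]; simpl in E2; unfold Ccomp, Cid in *.
    rewrite E1, E3, E4, <- E2, E5; exact E6.
  (* [H] acts as a holomorphic inverse of [h]. Writing [g z] as [h (H (g z))] turns [h (g z)] into
     [g (g (H (g z)))]; two applications of [ginv] leave [H (g z)], which [f] sends to [ginv (g z)],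
     that is [z]. *)
  - set (H := germ_pow h n).
    assert (HHg : hgerm (Ccomp H g) (m ^ n * l)) by (apply hgerm_comp; auto; apply hgerm_pow; auto).
    assert (HgH : hgerm (Ccomp g (Ccomp H g)) (l * (m ^ n * l))) by (apply hgerm_comp; auto).
    assert (N1 := hgerm_near _ _ _ Hg F); assert (N2 := hgerm_near _ _ _ Hg Oh).
    assert (N3 := hgerm_near _ _ _ HHg Sq); assert (N4 := hgerm_near _ _ _ HgH I1).
    assert (N5 := hgerm_near _ _ _ HHg I1); assert (N6 := hgerm_near _ _ _ HHg F).
    eapply near_imp; [|exact (near_and _ _ (near_and _ _ (near_and _ _ N1 N2) (near_and _ _ N3 N4))
      (near_and _ _ (near_and _ _ N5 N6) I1))].
    intros z [[[E1 E2] [E3 E4]] [[E5 E6] E7]]; simpl in E2, E3; fold H in E2.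
    unfold Ccomp, Cid in *.
    rewrite E1; rewrite <- E2 at 1; rewrite <- E3, E4, E5, E6, E2; exact E7.
Qed.

Theorem theorem1p5 (p : nat) (f : C -> C) :
  (1 <= p)%nat -> inG f -> inAp p f ->
  (reversible f <->
   exists (g h ginv : C -> C) (s : nat),
     inH g /\ inH h /\ (1 <= s)%nat /\
     has_order g (2 * s) /\ has_order h (2 * s) /\
     germ_eq (germ_pow g 2) (germ_pow h 2) /\
     Nat.divide s p /\ Nat.odd (p / s) = true /\
     germ_inv g ginv /\ germ_eq f (Ccomp ginv h)).
Proof.
  intros Hp _ HA; destruct p as [|p]; [lia|]; split.
  - apply reversible_factorization; auto.
  - intros [g [h [ginv [s [[HG _] [[HH _] [Hs [_ [[_ [Oh _]] [Sq [_ [_ [Ig F]]]]]]]]]]]]].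
    (* A successor exponent exposes the power [2 * s - 1] of [h] as its inverse. *)
    replace (2 * s)%nat with (S (2 * s - 1)) in Oh by lia.
    exact (factorization_reversible f g h ginv _ HG HH Oh Sq Ig F).
Qed.
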